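(* Let $G$ be a virtually polycyclic group and let $\varphi\in\operatorname{End}(G)$. The value of $\tilde R(\varphi,N)$ is independent of the choice of $N$: if $N$ and $N'$ are two finite index normal $\mathcal{NR}$-subgroups of $G$ with $\varphi(N)\le N$ and $\varphi(N')\le N'$, then $\tilde R(\varphi,N)=\tilde R(\varphi,N')$.
   Context: $\iota_g$ denotes $x\mapsto gxg^{-1}$. For $H\le G$, $\sqrt[G]{H}:=\{g\in G\mid\exists k\in\mathbb{N}: g^k\in H\}$. $\mathcal{NR}$-groups: a polycyclic group $G$ is strongly torsion-free if there is a short exact sequence $1\to K\to G\to\mathbb{Z}^n\to1$ with $K$ finitely generated torsion-free nilpotent. An $\mathcal{NR}$-group is a strongly torsion-free polycyclic group $G$ such that, for $H:=\sqrt[G]{[G,G]}$ and a central series $H=H_1\ge\cdots\ge H_{c+1}=1$ of $H$ with all $H_i$ normal in $G$ and all $H_i/H_{i+1}$ free abelian, for every $g\in G$ and every $i$ the automorphism of $H_i/H_{i+1}$ induced by $\iota_g$ has no root of unity other than $1$ as an eigenvalue (this is independent of the chosen series). Subgroups of $\mathcal{NR}$-groups are $\mathcal{NR}$-groups. Invariant $\tau$: for an $\mathcal{NR}$-group $G$ put $H:=\sqrt[G]{[G,G]}$, $\mathcal F_0(G):=G$, $\mathcal F_i(G):=\sqrt[H]{\gamma_i(H)}$ for $1\le i\le c+1$ (with $\gamma_i$ the lower central series, $\mathcal F_{c+1}(G)=1$). These terms are fully invariant and $\mathcal F_i(G)/\mathcal F_{i+1}(G)\cong\mathbb{Z}^{n_i}$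 for $0\le i\le c$. For $\varphi\in\operatorname{End}(G)$ inducing $\varphi_i\in\mathbb{Z}^{n_i\times n_i}$ on these factors, $\tau(\varphi):=\prod_{i=0}^c|\det(I_{n_i}-\varphi_i)|$ (the determinant of a $0\times 0$ matrix is $1$). Definition of $\tilde R(\varphi,N)$: let $G$ be virtually polycyclic, $\varphi\in\operatorname{End}(G)$, $N$ a finite index normal $\mathcal{NR}$-subgroup of $G$ with $\varphi(N)\le N$. Let $P_\varphi$ be the map $[t]_G\mapsto[\varphi(t)]_G$ on the (finite) set of $G$-conjugacy classes of torsion elements of $G$. For each $[t]_G\in\operatorname{Fix}(P_\varphi)$ choose a representative $t$ and $g_t\in G$ with $t=g_t\varphi(t)g_t^{-1}$; set $C_t:=C_G(t)$, $D_t:=C_N(t)$, $\varphi_t:=\iota_{g_t}\varphi$ ($C_t$ and $D_t$ are $\varphi_t$-invariant and $D_t$ is a normal finite index $\mathcal{NR}$-subgroup of $C_t$). Then $$\tilde R(\varphi,N):=\sum_{[t]_G\in\operatorname{Fix}(P_\varphi)}\frac{1}{[C_t:D_t]}\sum_{cD_t\in C_t/D_t}\tau\big((\iota_c\varphi_t)|_{D_t}\big),$$ which for fixed $\varphi$ and $N$ does not depend on the choices of $t$, $g_t$ and coset representatives $c$. *)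

(* Defs.v *)
From HB Require Import structures.
From mathcomp Require Import all_boot all_order all_algebra all_field.
From mathcomp Require Import finmap.
From mathcomp Require Import all_classical.

Set Implicit Arguments.
Unset Strict Implicit.
Unset Printing Implicit Defensive.

Import Order.TTheory GRing.Theory Num.Theory.
Local Open Scope classical_set_scope.
Local Open Scope ring_scope.

(* Groups are [groupType]s, possibly infinite; the subgroups of a group G are *)
(* the sets A : set G satisfying [subgroup A].                                *)

Section Subgroups.
Variable G : groupType.
Implicit Types (A B H K N S : set G) (g x y : G).

Definition iota g : G -> G := fun x => (g * x * g^-1)%g.

Definition subgroup A : Prop :=
  A 1%g /\ forall x y, A x -> A y -> A (x / y)%g.

Definition generated S : set G := smallest subgroup S.

Definition normal_subgroup A B : Prop :=
  [/\ subgroup A, subgroup B, A `<=` B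
    & forall b a, B b -> A a -> A (iota b a)].

Definition lcoset A x : set G := [set (x * a)%g | a in A].

Definition lcosets A B : set (set G) := [set lcoset A x | x in B].

Definition finite_index A B : Prop := finite_set (lcosets A B).

(* [B : A], meaningful when [finite_index A B] *)
Definition subgroup_index A B : nat := #|` fset_set (lcosets A B)|.

Definition commutator A B : set G :=
  generated [set z | exists2 x, A x & exists2 y, B y & z = [~ x, y]%g].

(* gamma_i(H) for i >= 1; the index 0 is unused *)
Definition lower_central H (i : nat) : set G :=
  iter i.-1 (fun A => commutator A H) H.

Definition nilpotent H : Prop :=
  exists c : nat, lower_central H c.+1 = [set 1%g].

(* the least c with gamma_(c+1)(H) = 1, when H is nilpotent *)
Definition nilpotency_class H : nat :=
  xget 0%N [set c : nat | lower_central H c.+1 = [set 1%g] /\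
    forall d : nat, lower_central H d.+1 = [set 1%g] -> (c <= d)%N].

Definition isolator B A : set G :=
  [set g | B g /\ exists2 k : nat, (0 < k)%N & A (g ^+ k)%g].

Definition torsion x : Prop := exists2 k : nat, (0 < k)%N & (x ^+ k = 1)%g.

Definition torsion_free A : Prop := forall x, A x -> torsion x -> x = 1%g.

Definition finitely_generated A : Prop :=
  exists2 S, finite_set S & generated S = A.

(* A / B is cyclic, generated by the coset xB *)
Definition cyclic_quotient A B : Prop :=
  exists2 x, A x & forall y, A y -> exists k : nat,
    lcoset B y = lcoset B (x ^+ k)%g \/ lcoset B y = lcoset B (x ^- k)%g.

Definition polycyclic A : Prop :=
  exists (n : nat) (S : nat -> set G),
    [/\ S 0%N = A, S n = [set 1%g]
      & forall i, (i < n)%N ->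
          normal_subgroup (S i.+1) (S i) /\ cyclic_quotient (S i) (S i.+1)].

(* p induces an isomorphism from A / B onto Z^n *)
Definition quotient_iso A B (n : nat) (p : G -> 'rV[int]_n) : Prop :=
  [/\ forall x y, A x -> A y -> p (x * y)%g = p x + p y,
      p @` A = setT
    & A `&` [set x | p x = 0] = B].

(* In the coordinates p, f induces the matrix M on A / B. Coordinates are row *)
(* vectors, so M is the transpose of the matrix acting on columns.            *)
Definition induced_matrix A (n : nat) (p : G -> 'rV[int]_n) (f : G -> G)
    (M : 'M[int]_n) : Prop :=
  forall x, A x -> p (f x) = p x *m M.

Definition strongly_torsion_free A : Prop :=
  polycyclic A /\
  exists K, [/\ subgroup K, finitely_generated K, torsion_free K, nilpotent K
    & exists (n : nat) (p : G -> 'rV[int]_n), quotient_iso A K p].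

(* the endomorphism of A / B = Z^n induced by f has no root of unity other    *)
(* than 1 as an eigenvalue                                                    *)
Definition only_trivial_unity_eigenvalue A B (f : G -> G) : Prop :=
  forall (n : nat) (p : G -> 'rV[int]_n) (M : 'M[int]_n),
    quotient_iso A B p -> induced_matrix A p f M ->
    forall (z : algC) (k : nat), (0 < k)%N -> k.-unity_root z ->
      eigenvalue (map_mx (intr : int -> algC) M) z -> z = 1.

Definition derived_isolator N : set G := isolator N (commutator N N).

Definition NR_group N : Prop :=
  strongly_torsion_free N /\
  let H := derived_isolator N in
  exists (c : nat) (S : nat -> set G),
    [/\ S 1%N = H,
        S c.+1 = [set 1%g],
        (forall i, (0 < i <= c.+1)%N -> normal_subgroup (S i) N)
      & forall i, (0 < i <= c)%N ->
          [/\ S i.+1 `<=` S i,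
              commutator (S i) H `<=` S i.+1,
              (exists (n : nat) (p : G -> 'rV[int]_n),
                 quotient_iso (S i) (S i.+1) p)
            & forall g, N g ->
                only_trivial_unity_eigenvalue (S i) (S i.+1) (iota g)]].

(* F_i(N) *)
Definition filtration N (i : nat) : set G :=
  let H := derived_isolator N in
  if i is 0 then N else isolator H (lower_central H i).

(* det(I - M), for M the matrix induced by f on A / B = Z^n; it does not      *)
(* depend on the coordinates                                                  *)
Definition quotient_det A B (f : G -> G) : int :=
  xget 0 [set d | exists (n : nat) (p : G -> 'rV[int]_n) (M : 'M[int]_n),
    [/\ quotient_iso A B p, induced_matrix A p f M & d = \det (1%:M - M)]].

Definition tau N (f : G -> G) : nat :=
  let c := nilpotency_class (derived_isolator N) in
  (\prod_(0 <= i < c.+1)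
     `|quotient_det (filtration N i) (filtration N i.+1) f|)%N.

Definition conjugacy_class x : set G := [set iota g x | g in setT].

Definition torsion_classes : set (set G) :=
  [set conjugacy_class t | t in torsion].

(* the map [t] |-> [phi t] on conjugacy classes *)
Definition class_map (phi : G -> G) (X : set G) : set G :=
  \bigcup_(t in X) conjugacy_class (phi t).

Definition fixed_torsion_classes (phi : G -> G) : set (set G) :=
  torsion_classes `&` [set X | class_map phi X = X].

Definition centralizer A x : set G := [set g | A g /\ commute g x].

(* The summand of the class X; the representatives t of X, g_t and those of   *)
(* the cosets are picked by the choice operator [xget].                       *)
Definition Rtilde_term (phi : G -> G) N (X : set G) : rat :=
  let t := xget 1%g X in
  let g_t := xget 1%g [set g | t = iota g (phi t)] in
  let C_t := centralizer setT t in
  let D_t := centralizer N t in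
  let phi_t := iota g_t \o phi in
  (subgroup_index D_t C_t)%:R^-1 *
  \sum_(Y \in lcosets D_t C_t)
     ((tau D_t (iota (xget 1%g Y) \o phi_t))%:R : rat).

Definition Rtilde (phi : G -> G) N : rat :=
  \sum_(X \in fixed_torsion_classes phi) Rtilde_term phi N X.

Definition virtually_polycyclic : Prop :=
  exists A, [/\ subgroup A, finite_index A setT & polycyclic A].

End Subgroups.

Arguments virtually_polycyclic G : clear implicits.

(* Main.v *)
From HB Require Import structures.
Require Import Defs.
From mathcomp Require Import all_boot all_order all_algebra all_field.
From mathcomp Require Import finmap.
From mathcomp Require Import all_classical.
(* Imported again: [iota] must mean conjugation, not the interval of [seq]. *)
Require Import Defs.

(* Replacing N' by the intersection K of N and N', it suffices to compare N with *)
(* a normal subgroup K <= N of finite index. For a torsion element t fixed up to *)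
(* conjugacy, C_K(t) has finite index in D = C_N(t), and both sums are averages  *)
(* over coset spaces of C_G(t). They agree because of two facts about an         *)
(* endomorphism psi of a subgroup D of an NR-group.                              *)
(*                                                                               *)
(* 1. tau(psi) does not change when D is replaced by a normal subgroup D' of     *)
(*    finite index. The eigenvalue condition forces the finite group D/D' to act *)
(*    trivially on the torsion-free part of the abelianization of D'; hence the  *)
(*    transfer to that group is a multiple of the projection on D', and it kills *)
(*    [D, D]. So the filtration of D' is the trace on D' of that of D, and the   *)
(*    induced matrices are conjugate over the rationals.                         *)
(*                                                                               *)
(* 2. tau(iota d psi) = tau(psi) for d in D. Let M0 and M be the matrices of psi *)
(*    on the first and on a later factor. If det(1 - M0) = 0 both sides vanish.  *)
(*    Otherwise some power of h = d psi(d) ... psi^(k-1)(d) is a psi^k-coboundary*)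
(*    x psi^k(x)^-1 modulo the second term of the filtration, so the sequence    *)
(*    tr(A^j M^k), where A is the action of h, is periodic in j. It also         *)
(*    satisfies a linear recurrence whose characteristic polynomial has no root  *)
(*    of unity other than 1 as a root, so it is constant. Hence the k-th powers  *)
(*    of the matrices of iota d psi and of psi have equal traces for all k, and  *)
(*    the two characteristic polynomials coincide.                               *)

Set Implicit Arguments.
Unset Strict Implicit.
Unset Printing Implicit Defensive.

Import Order.TTheory GRing.Theory Num.Theory.
Local Open Scope classical_set_scope.
Local Open Scope ring_scope.

(** * Matrices *)

(** The first fact is [tau_finite_index], the second [tau_iota], both for a subgroup D of an
    NR-group N. By [tau_iota] the summand is constant on the cosets of C_N(t), so [average_cosets]
    lets the sum run over the finer cosets of C_K(t) instead; by [tau_finite_index] the summands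
    then agree. This is [class_average_subgroup].

    The NR condition on N reaches the sections of D through [NR_annihilated]: for g in N a single
    integer polynomial, with no root of unity other than 1 as a root, annihilates the matrix of
    conjugation by g on every free abelian section of N that it preserves. A matrix of finite order
    annihilated in this way is trivial ([finite_order_eq1]), and a periodic trace sequence along its
    powers is constant ([periodic_trace]).

    For the nilpotent group H, the isolator of [D, D], the comparison of lower central series rests
    on [gam_power], and the centrality of the isolated series on [central_root]. *)

Local Notation toC := (map_mx (intr : int -> algC)).

Lemma toC_X n (A : 'M[int]_n) k : toC (A ^+ k) = toC A ^+ k.
Proof. by elim: k => [|k IH]; rewrite ?expr0 ?map_mx1// !exprS map_mxM IH. Qed.

Lemma trig_mulmx (R : pzRingType) n (A B : 'M[R]_n) :
  is_trig_mx A -> is_trig_mx B ->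
  is_trig_mx (A *m B) /\ forall i, (A *m B) i i = A i i * B i i.
Proof.
move=> /is_trig_mxP tA /is_trig_mxP tB; split=> [|i].
  apply/is_trig_mxP => i j ij; rewrite mxE big1// => k _.
  have [ik|ki] := ltnP i k; first by rewrite tA// mul0r.
  by rewrite tB ?mulr0// (leq_ltn_trans ki).
rewrite mxE (bigD1 i)//= big1 ?addr0// => k.
rewrite neq_ltn => /orP[ki|ik]; last by rewrite tA// mul0r.
by rewrite tB ?mulr0.
Qed.

Lemma trig_exprmx (R : pzRingType) n (A : 'M[R]_n) k : is_trig_mx A ->
  is_trig_mx (A ^+ k) /\ forall i, (A ^+ k) i i = A i i ^+ k.
Proof.
move=> tA; elim: k => [|k [tAk IH]].
  split=> [|i]; last by rewrite !expr0 mxE eqxx.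
  by rewrite expr0; apply/is_trig_mxP => i j; rewrite mxE -val_eqE ltn_neqAle => /andP[/negPf->].
have [tS dS] := trig_mulmx tA tAk.
by split=> [|i]; rewrite exprS// dS IH exprS.
Qed.

(** Equal power sums give equal sums of q(x) for every polynomial q. A polynomial that vanishes at
    all entries except a then compares the multiplicities of a. *)
Lemma perm_eq_power_sums (s t : seq algC) :
  (forall k, \sum_(x <- s) x ^+ k = \sum_(x <- t) x ^+ k) -> perm_eq s t.
Proof.
move=> st; have stq (q : {poly algC}) : \sum_(x <- s) q.[x] = \sum_(x <- t) q.[x].
  under eq_bigr do rewrite horner_coef.
  under [RHS]eq_bigr do rewrite horner_coef.
  rewrite exchange_big [RHS]exchange_big/=; apply: eq_bigr => i _.
  by rewrite -!mulr_sumr st.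
apply/allP => a _ /=; apply/eqP.
pose U := undup (s ++ t); pose q := \prod_(b <- U | b != a) ('X - b%:P).
have q0 b : b \in s ++ t -> b != a -> q.[b] = 0.
  move=> bU ba; rewrite horner_prod; apply/eqP; rewrite prodf_seq_eq0.
  by apply/hasP; exists b; rewrite ?mem_undup//= ba !hornerE subrr.
have qa : q.[a] != 0.
  rewrite horner_prod prodf_seq_neq0; apply/allP => b _; apply/implyP => ba.
  by rewrite !hornerE subr_eq0 eq_sym.
have cnt (r : seq algC) : {subset r <= s ++ t} ->
    \sum_(x <- r) q.[x] = (count_mem a r)%:R * q.[a].
  move=> rst; rewrite (bigID (pred1 a))/= [X in _ + X]big_seq_cond.
  rewrite [X in _ + X]big1 ?addr0; last by move=> b /andP[/rst]; exact: q0.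
  rewrite (eq_bigr (fun=> q.[a])); last by move=> b /eqP->.
  by rewrite -[in RHS]sum1_count natr_sum mulr_suml; apply: eq_bigr => *; rewrite mul1r.
have := stq q; rewrite !cnt; [|by move=> x xt; rewrite mem_cat xt ?orbT..].
by move/(mulIf qa)/eqP; rewrite eqr_nat => /eqP.
Qed.

(** After Schur triangularization the traces of powers are the power sums of the eigenvalues, so
    both matrices have the same spectrum with multiplicities. *)
Lemma det_sub1_of_traces n (A B : 'M[algC]_n) :
  (forall k, (0 < k)%N -> \tr (A ^+ k) = \tr (B ^+ k)) ->
  \det (1%:M - A) = \det (1%:M - B).
Proof.
case: n => [|n] in A B * => tAB; first by congr (\det _); apply/matrixP => -[].
have eig (M : 'M[algC]_n.+1) : exists d : 'I_n.+1 -> algC,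
    (forall k, \tr (M ^+ k) = \sum_i d i ^+ k) /\ \det (1%:M - M) = \prod_i (1 - d i).
  have [P /unitarymx_unit uP tT] := @Schur _ _ M isT.
  have [T {}tT TE] : exists2 T, is_trig_mx T & T = P *m M *m invmx P.
    by exists (conjmx P M); [exact: tT | rewrite conjumx].
  exists (fun i => T i i).
  have MP : M *m invmx P = invmx P *m T by rewrite TE !mulmxA mulVmx// mul1mx.
  have MT k : M ^+ k = invmx P *m T ^+ k *m P.
    elim: k => [|k IH]; first by rewrite !expr0 mulmx1 mulVmx.
    by rewrite !exprS IH -!mulmxE !mulmxA MP.
  split=> [k|].
    rewrite MT -mulmxA mxtrace_mulC -mulmxA mulmxV// mulmx1.
    by apply: eq_bigr => i _; rewrite (trig_exprmx k tT).2.
  have -> : 1%:M - M = invmx P *m (1%:M - T) *m P.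
    by rewrite mulmxBr mulmxBl mulmx1 mulVmx// -[M]expr1 MT.
  rewrite 2!det_mulmx mulrAC -det_mulmx mulVmx// det1 mul1r det_trig.
    by apply: eq_bigr => i _; rewrite !mxE eqxx.
  by apply/is_trig_mxP => i j ij; rewrite !mxE (is_trig_mxP tT)// -val_eqE ltn_eqF// subr0.
have [[dA [tA ->]] [dB [tB ->]]] := (eig A, eig B).
have : perm_eq [seq dA i | i <- enum 'I_n.+1] [seq dB i | i <- enum 'I_n.+1].
  apply: perm_eq_power_sums => k; rewrite !big_map -!enumT !big_enum/=.
  have [->|k0] := posnP k; first by apply: eq_bigr => i _; rewrite !expr0.
  by rewrite -tA -tB tAB.
move=> dAB; have := perm_big _ dAB : \prod_(x <- _) (1 - x) = \prod_(x <- _) (1 - x).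
by rewrite !big_map -!enumT !big_enum.
Qed.

(** * Integer matrices without nontrivial roots of unity as eigenvalues *)

Definition trivial_unity_roots (P : {poly int}) : Prop :=
  forall (z : algC) k, (0 < k)%N -> k.-unity_root z ->
    root (map_poly intr P) z -> z = 1.

(** An explicit sum, because [horner_mx] only applies in positive dimension and factors of rank 0
    occur. *)
Definition annihilates (P : {poly int}) n (M : 'M[int]_n) : Prop :=
  \sum_(i < size P) P`_i *: M ^+ i = 0.

Lemma annihilatesP P n (M : 'M[int]_n.+1) : annihilates P M <-> horner_mx M P = 0.
Proof.
rewrite /annihilates -[in X in _ <-> X](coefK P) poly_def rmorph_sum/=.
by under [in X in _ <-> X]eq_bigr do rewrite linearZ rmorphXn/= horner_mx_X.
Qed.

(** The functional q |-> tr(q(A) B) vanishes on the multiples of P and, by periodicity, on those of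
    X^k - 1. Over the algebraic numbers these two ideals together contain X - 1, and its value there
    is tr(A B) - tr(B). *)
Lemma periodic_trace P n (A B : 'M[int]_n) k : trivial_unity_roots P ->
  annihilates P A -> (0 < k)%N ->
  (forall j, \tr (A ^+ (j + k) *m B) = \tr (A ^+ j *m B)) ->
  \tr (A *m B) = \tr B.
Proof.
case: n => [|n] in A B * => rP; first by move=> *; congr (\tr _); apply/matrixP => -[].
move=> /annihilatesP PA k0 per.
have intrI : injective (intr : int -> algC) by exact: intr_inj.
apply: intrI; rewrite -!trace_map_mx map_mxM.
pose l (q : {poly algC}) := \tr (horner_mx (toC A) q *m toC B).
have lD q r : l (q + r) = l q + l r by rewrite /l rmorphD mulmxDl linearD.
have lB q r : l (q - r) = l q - l r by rewrite /l rmorphB mulmxBl linearB.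
have lZ c q : l (c *: q) = c * l q by rewrite /l linearZ -scalemxAl linearZ.
pose PC : {poly algC} := map_poly intr P.
have lP q : l (q * PC) = 0.
  by rewrite /l rmorphM/= -map_horner_mx PA map_mx0 mulr0 mul0mx linear0.
have lX q : l (q * ('X^k - 1)) = 0.
  elim/poly_ind: q => [|q c IH]; first by rewrite mul0r /l rmorph0 mul0mx linear0.
  suff lXn j : l ('X^j * ('X^k - 1)) = 0.
    rewrite -[q * _ + _]coefK poly_def mulr_suml.
    by elim/big_rec: _ => [|i r _ lr]; rewrite ?lD ?lr -?scalerAl ?lZ ?lXn ?mulr0 ?addr0//
      /l rmorph0 mul0mx linear0.
  rewrite mulrBr mulr1 -exprD lB /l !rmorphXn/= !horner_mx_X -!toC_X/= -!map_mxM.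
  by rewrite !trace_map_mx per subrr.
(* 'X^k - 1 is ('X - 1) * Phi, and no root of Phi is a root of P. *)
pose Phi : {poly algC} := \sum_(i < k) 'X^i.
have /Bezout_coprimepP[[u v]/= /eqpP[[c d]/= /andP[c0 d0] uv]] : coprimep PC Phi.
  apply/Pdiv.ClosedField.coprimepP => z Pz; apply/eqP => Phiz.
  have zk : k.-unity_root z.
    apply/unity_rootP/eqP; rewrite -subr_eq0 subrX1.
    by move: Phiz; rewrite horner_sum; under eq_bigr do rewrite hornerXn; move=> ->; rewrite mulr0.
  have z1 := rP z k k0 zk Pz; move: Phiz; rewrite z1 horner_sum.
  under eq_bigr do rewrite hornerXn expr1n.
  by rewrite sumr_const card_ord => /eqP; rewrite pnatr_eq0 (gtn_eqF k0).
have : l ((c *: (u * PC + v * Phi)) * ('X - 1)) = 0.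
  rewrite -scalerAl lZ mulrDl lD mulrAC lP add0r.
  by rewrite -mulrA [Phi * _]mulrC -subrX1 lX mulr0.
rewrite uv -scalerAl lZ mul1r lB => /eqP; rewrite mulf_eq0 (negPf d0)/= subr_eq0 => /eqP.
by rewrite /l horner_mx_X rmorph1 mul1mx.
Qed.

(** The trace against an elementary matrix reads off one entry, so [periodic_trace] applies entry by
    entry. *)
Lemma finite_order_eq1 P n (B : 'M[int]_n) m : trivial_unity_roots P ->
  annihilates P B -> (0 < m)%N -> B ^+ m = 1 -> B = 1%:M.
Proof.
move=> rP PB m0 Bm; apply/matrixP => i j.
have trd (C : 'M[int]_n) : \tr (C *m delta_mx j i) = C i j.
  rewrite /mxtrace (bigD1 i)//= mxE (bigD1 j)//= mxE !eqxx mulr1 !big1 ?addr0//.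
    by move=> k ki; rewrite mxE big1// => x _; rewrite mxE (negPf ki) andbF mulr0.
  by move=> k kj; rewrite mxE (negPf kj) mulr0.
rewrite -!trd mul1mx; apply: (periodic_trace rP PB m0) => k.
by rewrite exprD Bm mulr1.
Qed.

Lemma det_sub1_of_int_traces n (A B : 'M[int]_n) :
  (forall k, (0 < k)%N -> \tr (A ^+ k) = \tr (B ^+ k)) ->
  \det (1%:M - A) = \det (1%:M - B).
Proof.
move=> tAB; have intrI : injective (intr : int -> algC) by exact: intr_inj.
apply: intrI; rewrite -!det_map_mx !map_mxB !map_mx1.
by apply: det_sub1_of_traces => k k0; rewrite -!toC_X !trace_map_mx tAB.
Qed.

(** * Subgroups and quotients *)

Section SubgroupTheory.
Variable G : groupType.
Implicit Types (A B : set G) (x y g : G).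
Local Open Scope group_scope.

Lemma subg1 A : subgroup A -> A 1. Proof. by case. Qed.
Lemma subgV A x : subgroup A -> A x -> A x^-1.
Proof. by case=> A1 AF Ax; rewrite -div1g; exact: AF. Qed.
Lemma subgM A x y : subgroup A -> A x -> A y -> A (x * y).
Proof. by move=> sA Ax Ay; rewrite -[y]invgK; apply: sA.2 => //; exact: subgV. Qed.
Lemma subgX A x k : subgroup A -> A x -> A (x ^+ k).
Proof.
move=> sA Ax; elim: k => [|k IH]; first by rewrite expg0; exact: subg1.
by rewrite expgS; exact: subgM.
Qed.
Lemma subgJ A x y : subgroup A -> A x -> A y -> A (x ^ y).
Proof. by move=> sA Ax Ay; rewrite conjgE; do 2?[apply: subgM => //]; exact: subgV. Qed.
Lemma subgR A x y : subgroup A -> A x -> A y -> A [~ x, y].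
Proof. by move=> sA Ax Ay; rewrite commgEl; apply: subgM => //; [exact: subgV|exact: subgJ]. Qed.
Lemma subg_iota A x y : subgroup A -> A x -> A y -> A (iota x y).
Proof. by move=> sA Ax Ay; rewrite /iota; do 2?[apply: subgM => //]; exact: subgV. Qed.

Lemma iotaE g x : iota g x = x ^ g^-1.
Proof. by rewrite conjgE invgK mulgA. Qed.
Lemma iotaR g x : iota g x = [~ g^-1, x^-1] * x.
Proof. by rewrite /iota commgEl conjgE !invgK -!mulgA mulVg mulg1. Qed.
Lemma iota1 : iota (1 : G) =1 id.
Proof. by move=> x; rewrite iotaE invg1 conjg1. Qed.
Lemma iota_mul g h x : iota (g * h) x = iota g (iota h x).
Proof. by rewrite !iotaE invgM conjgM. Qed.

Lemma subgroupI A B : subgroup A -> subgroup B -> subgroup (A `&` B).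
Proof.
move=> sA sB; split=> [|x y [Ax Bx] [Ay By]]; first by split; exact: subg1.
by split; [exact: sA.2 | exact: sB.2].
Qed.

Lemma normalJ B A x y : normal_subgroup B A -> B x -> A y -> B (x ^ y).
Proof.
case=> _ sA _ nBA Bx Ay; rewrite -[y]invgK -iotaE; apply: nBA => //; exact: subgV.
Qed.

End SubgroupTheory.

Ltac grp := repeat first [ done | apply: subgR | apply: subgJ | apply: subgX
  | apply: subg_iota | apply: subgM | apply: subgV | apply: subg1 ].

Section QuotientGroup.
Variables (G : groupType) (B A : set G).
Local Open Scope group_scope.
Hypothesis nBA : normal_subgroup B A.

(** The quotient is built as a genuine [groupType], so that congruences modulo B become equations
    between group elements. *)
Definition coset_type := {X : set G | `[< exists2 x, A x & X = lcoset B x >]}.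
HB.instance Definition _ := Choice.on coset_type.

Lemma lcoset_eq x y : subgroup B -> (lcoset B x = lcoset B y) <-> B (x^-1 * y).
Proof.
move=> sB; split=> [e|Bxy].
  have : lcoset B y y by exists 1; rewrite ?mulg1//; exact: subg1.
  by rewrite -e => -[b Bb <-]; rewrite mulKg.
apply/seteqP; split=> _ [b Bb <-].
  exists ((x^-1 * y)^-1 * b); first by grp.
  by rewrite invgM invgK -!mulgA mulVKg.
by exists (x^-1 * y * b); [grp | rewrite !mulgA mulgV mul1g].
Qed.

Lemma coset_repr (X : coset_type) : exists x, A x /\ val X = lcoset B x.
Proof. by case: X => X /= /asboolP[x Ax ->]; exists x. Qed.
Definition repr_coset X := projT1 (cid (coset_repr X)).
Lemma repr_cosetP X : A (repr_coset X) /\ val X = lcoset B (repr_coset X).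
Proof. exact: (projT2 (cid (coset_repr X))). Qed.

Lemma to_coset_subproof x : `[< exists2 y, A y & lcoset B (if `[< A x >] then x else 1) = lcoset B y >].
Proof.
have [_ sA _ _] := nBA.
by apply/asboolP; eexists; last reflexivity; case: asboolP => // _; exact: subg1.
Qed.
(** Elements outside A go to the trivial coset; the projection is thus total, but multiplicative on
    A only. *)
Definition to_coset x : coset_type :=
  exist (fun X : set G => `[< exists2 y, A y & X = lcoset B y >]) _ (to_coset_subproof x).

Lemma to_coset_eq x y : A x -> A y -> (to_coset x = to_coset y) <-> B (x^-1 * y).
Proof.
have [sB _ _ _] := nBA.
move=> Ax Ay; rewrite -lcoset_eq//; split=> [/(congr1 val)|e]; last apply: val_inj; move=> /=;
  by rewrite !asboolT.
Qed.

Lemma repr_cosetK X : to_coset (repr_coset X) = X.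
Proof. by have [Ax Xx] := repr_cosetP X; apply: val_inj => /=; rewrite asboolT. Qed.

Lemma to_cosetK x : A x -> B (x^-1 * repr_coset (to_coset x)).
Proof.
move=> Ax; apply/to_coset_eq => //; rewrite ?repr_cosetK//.
by have [] := repr_cosetP (to_coset x).
Qed.

Definition mul_coset X Y := to_coset (repr_coset X * repr_coset Y).
Definition one_coset := to_coset 1.
Definition inv_coset X := to_coset (repr_coset X)^-1.

Let Ar X : A (repr_coset X). Proof. by have [] := repr_cosetP X. Qed.

Lemma mul_to_coset x y : A x -> A y -> mul_coset (to_coset x) (to_coset y) = to_coset (x * y).
Proof.
have [sB sA sBA _] := nBA.
move=> Ax Ay; apply/esym/to_coset_eq; [by grp|by apply: subgM|].
have Bx := to_cosetK Ax; have By := to_cosetK Ay.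
set x' := repr_coset _ in Bx *; set y' := repr_coset _ in By *.
have -> : (x * y)^-1 * (x' * y') = (x^-1 * x') ^ y * (y^-1 * y').
  by rewrite conjgE invgM -!mulgA mulVKg.
by apply: subgM => //; exact: normalJ Bx Ay.
Qed.

Lemma mul_cosetA : associative mul_coset.
Proof.
have [_ sA _ _] := nBA.
move=> X Y Z; rewrite -(repr_cosetK X) -(repr_cosetK Y) -(repr_cosetK Z).
by rewrite !mul_to_coset ?mulgA//; grp.
Qed.
Lemma mul1_coset : left_id one_coset mul_coset.
Proof.
have [_ sA _ _] := nBA.
by move=> X; rewrite -(repr_cosetK X) mul_to_coset ?mul1g//; grp.
Qed.
Lemma mul_coset1 : right_id one_coset mul_coset.
Proof.
have [_ sA _ _] := nBA.
by move=> X; rewrite -(repr_cosetK X) mul_to_coset ?mulg1//; grp.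
Qed.
Lemma mulV_coset : left_inverse one_coset inv_coset mul_coset.
Proof.
have [_ sA _ _] := nBA.
by move=> X; rewrite -{2}(repr_cosetK X) mul_to_coset ?mulVg//; grp.
Qed.
Lemma mul_cosetV : right_inverse one_coset inv_coset mul_coset.
Proof.
have [_ sA _ _] := nBA.
by move=> X; rewrite -{1}(repr_cosetK X) mul_to_coset ?mulgV//; grp.
Qed.

HB.instance Definition _ :=
  isGroup.Build coset_type mul_cosetA mul1_coset mul_coset1 mulV_coset mul_cosetV.

Lemma quotient_group : exists (Q : groupType) (pi : G -> Q),
  (forall x y, A x -> A y -> pi (x * y) = pi x * pi y) /\
  (forall x, A x -> (pi x = 1) <-> B x).
Proof.
have [sB sA _ _] := nBA.
exists coset_type, to_coset; split=> [x y Ax Ay|x Ax]; first by rewrite [RHS]mul_to_coset.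
rewrite [1]/(to_coset 1) to_coset_eq//; last exact: subg1.
rewrite mulg1; split=> Bx; last exact: subgV.
by rewrite -[x]invgK; exact: subgV.
Qed.

End QuotientGroup.

(** * Lower central series and isolators *)

Section GroupIdentities.
Variable G : groupType.
Implicit Types x y z : G.
Local Open Scope group_scope.

Lemma commgM_l x y z : [~ x * y, z] = [~ x, z] ^ y * [~ y, z].
Proof. by rewrite !commgEl !conjgE !invgM -!mulgA !mulVKg. Qed.

Lemma commgM_r x y z : [~ x, y * z] = [~ x, z] * [~ x, y] ^ z.
Proof. by rewrite !commgEl !conjgE !invgM -!mulgA !mulVKg. Qed.

Lemma commgX_l x y k : commute x [~ x, y] -> [~ x ^+ k, y] = [~ x, y] ^+ k.
Proof.
move=> cx; rewrite commgEl conjXg.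
have -> : x ^ y = x * [~ x, y] by rewrite commgEl mulVKg.
by rewrite expgMn// mulKg.
Qed.

Lemma commgX_r x y k : commute y [~ x, y] -> [~ x, y ^+ k] = [~ x, y] ^+ k.
Proof.
move=> cy; rewrite -[LHS]invgR commgX_l ?invgR -?expVgn ?invgR//.
by rewrite -invgR; exact: commuteV.
Qed.

End GroupIdentities.

Section Generated.
Variable G : groupType.
Implicit Types (A B H S : set G) (x y g : G).
Local Open Scope group_scope.

Lemma subgroup_intro A : A 1 -> (forall x y, A x -> A y -> A (x * y)) ->
  (forall x, A x -> A x^-1) -> subgroup A.
Proof. by move=> A1 AM AV; split=> // x y Ax Ay; apply: AM => //; exact: AV. Qed.

Lemma generated_subgroup S : subgroup (generated S).
Proof.
split=> [B [[]]//|x y Sx Sy B BS].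
by apply: BS.1.2; [exact: Sx | exact: Sy].
Qed.

Lemma sub_generated S : S `<=` generated S.
Proof. by move=> x Sx B [_]; exact. Qed.

Lemma generated_min S A : subgroup A -> S `<=` A -> generated S `<=` A.
Proof. by move=> sA SA x; apply. Qed.

(** Since f may be multiplicative only on a subgroup, its preimage of A need not be one; the
    condition is therefore put on the intersection. *)
Lemma generated_morph S A (f : G -> G) : subgroup A -> subgroup (generated S `&` f @^-1` A) ->
  (forall x, S x -> A (f x)) -> forall x, generated S x -> A (f x).
Proof.
move=> sA sfA fS x; have : generated S `<=` generated S `&` f @^-1` A; last by move=> h /h[].
by apply: generated_min => // y Sy; split; [exact: sub_generated|exact: fS].
Qed.

Lemma commutator_subgroup A B : subgroup (commutator A B).
Proof. exact: generated_subgroup. Qed.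

Lemma commutatorS A B x y : A x -> B y -> commutator A B [~ x, y].
Proof. by move=> Ax By; apply: sub_generated; exists x => //; exists y. Qed.

Lemma commutator_min A B H : subgroup H ->
  (forall x y, A x -> B y -> H [~ x, y]) -> commutator A B `<=` H.
Proof. by move=> sH AB; apply: generated_min => // _ [x Ax [y By ->]]; exact: AB. Qed.

End Generated.

Definition morph_on (G Q : groupType) (A : set G) (f : G -> Q) :=
  forall x y, A x -> A y -> f (x * y)%g = (f x * f y)%g.

Section MorphOn.
Variables (G Q : groupType) (A : set G) (f : G -> Q).
Local Open Scope group_scope.
Hypotheses (sA : subgroup A) (fM : morph_on A f).

Lemma morph_on1 : f 1 = 1.
Proof. by apply: (mulgI (f 1)); rewrite -fM ?mulg1//; exact: subg1. Qed.
Lemma morph_onV x : A x -> f x^-1 = (f x)^-1.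
Proof. by move=> Ax; apply: (mulIg (f x)); rewrite -fM ?mulVg ?morph_on1//; grp. Qed.
Lemma morph_onX x k : A x -> f (x ^+ k) = f x ^+ k.
Proof.
move=> Ax; elim: k => [|k IH]; first by rewrite !expg0 morph_on1.
by rewrite !expgS fM ?IH//; grp.
Qed.
Lemma morph_onJ x y : A x -> A y -> f (x ^ y) = f x ^ f y.
Proof. by move=> Ax Ay; rewrite !conjgE !fM ?morph_onV//; grp. Qed.
Lemma morph_onR x y : A x -> A y -> f [~ x, y] = [~ f x, f y].
Proof. by move=> Ax Ay; rewrite !commgEl !fM ?morph_onV ?morph_onJ//; grp. Qed.

Lemma morph_on_eq B : (forall x, A x -> (f x = 1) <-> B x) ->
  forall x y, A x -> A y -> (f x = f y) <-> B (x^-1 * y).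
Proof.
move=> fB x y Ax Ay; rewrite -fB; last by grp.
rewrite fM ?morph_onV//; last by grp.
split=> [->|e]; first by rewrite mulVg.
by rewrite -[f x]mulg1 -e mulVKg.
Qed.

End MorphOn.

(* gamma_(i+1)(H) *)
Local Notation gam H i := (lower_central H i.+1).

Section LowerCentral.
Variable G : groupType.
Implicit Types (A B H S : set G) (x y g : G).
Local Open Scope group_scope.

Lemma gamS H i : gam H i.+1 = commutator (gam H i) H. Proof. by []. Qed.

Lemma gam_subgroup H i : subgroup H -> subgroup (gam H i).
Proof. by case: i => [|i] // sH; exact: commutator_subgroup. Qed.

Lemma gam_conj H i x y : subgroup H -> gam H i x -> H y -> gam H i (x ^ y).
Proof.
move=> sH; elim: i x => [|i IH] x gx Hy; first exact: subgJ.
move: x gx; rewrite gamS => x gx.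
apply: (@generated_morph _ _ _ (fun x => x ^ y) _ _ _ x gx).
- exact: commutator_subgroup.
- split; first by split; [exact: subg1 (generated_subgroup _)
    | rewrite /preimage/= conj1g; exact: subg1 (generated_subgroup _)].
  move=> a b [ga ca] [gb cb]; split; first by apply: (generated_subgroup _).2.
  by rewrite /preimage/= conjMg conjVg; apply: (generated_subgroup _).2.
- move=> _ [a ga [b Hb ->]]; rewrite conjRg.
  by apply: commutatorS; [exact: IH | exact: subgJ].
Qed.

Lemma gamR H i x y : gam H i x -> H y -> gam H i.+1 [~ x, y].
Proof. exact: commutatorS. Qed.

Lemma gam_decr H i : subgroup H -> gam H i.+1 `<=` gam H i.
Proof.
move=> sH; apply: commutator_min; first exact: gam_subgroup.
move=> x y gx Hy; rewrite commgEl; apply: subgM; first exact: gam_subgroup.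
  by apply: subgV => //; exact: gam_subgroup.
exact: gam_conj.
Qed.

Lemma gam_le H i j : subgroup H -> (i <= j)%N -> gam H j `<=` gam H i.
Proof.
move=> sH; elim: j => [|j IH]; first by rewrite leqn0 => /eqP->.
rewrite leq_eqVlt => /predU1P[->//|/IH le]; exact: subset_trans (gam_decr sH) le.
Qed.

Lemma gam_sub H i : subgroup H -> gam H i `<=` H.
Proof. by move=> sH; apply: (@gam_le H 0). Qed.

Lemma gam_mono H H' i : subgroup H -> H' `<=` H -> gam H' i `<=` gam H i.
Proof.
move=> sH H'H; elim: i => [//|i IH]; apply: commutator_min; first exact: gam_subgroup.
by move=> x y gx Hy; apply: gamR; [exact: IH | exact: H'H].
Qed.

Lemma gam_normal H i : subgroup H -> normal_subgroup (gam H i) H.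
Proof.
move=> sH; split; [exact: gam_subgroup|by []|exact: gam_sub|].
by move=> b a Hb ga; rewrite iotaE; apply: gam_conj => //; exact: subgV.
Qed.

Lemma gam_image H i (f : G -> G) : subgroup H -> morph_on H f -> (forall x, H x -> H (f x)) ->
  forall x, gam H i x -> gam H i (f x).
Proof.
move=> sH fM fH; elim: i => [//|i IH] x gx.
apply: (@generated_morph _ _ _ f _ _ _ x gx).
- exact: commutator_subgroup.
- have gH : generated [set z | exists2 x, gam H i x & exists2 y, H y & z = [~ x, y]] `<=` H.
    exact: (@gam_sub H i.+1).
  split; first by split; [exact: subg1 (generated_subgroup _)
    | rewrite /preimage/= (morph_on1 sH fM); exact: subg1 (generated_subgroup _)].
  move=> a b [ga ca] [gb cb]; split; first by apply: (generated_subgroup _).2.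
  have [Ha Hb] := (gH _ ga, gH _ gb).
  rewrite /preimage/= fM ?(morph_onV sH fM)//; last by grp.
  exact: (generated_subgroup _).2.
- move=> _ [a ga [b Hb ->]]; rewrite (morph_onR sH fM)//; last exact: gam_sub ga.
  by apply: commutatorS; [exact: IH | exact: fH].
Qed.

(** Modulo the next term, the term of index i becomes central, and commutators landing in it become
    multiplicative in each entry. *)
Lemma gam_quotient H i : subgroup H -> exists (Q : groupType) (pi : G -> Q),
  [/\ morph_on H pi, forall x, H x -> (pi x = 1) <-> gam H i.+1 x
    & forall x y, gam H i x -> H y -> commute (pi x) (pi y)].
Proof.
move=> sH; have [Q [pi [piM piK]]] := quotient_group (gam_normal i.+1 sH).
exists Q, pi; split=> // x y gx Hy; have Hx := gam_sub sH gx.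
apply/commgP; rewrite -(morph_onR sH piM)//; apply/eqP.
by apply/piK; [exact: subgR | exact: gamR].
Qed.

Section Powers.
Variables (H H' S : set G) (c : nat).
Hypotheses (sH : subgroup H) (sH' : subgroup H') (H'H : H' `<=` H).
Hypotheses (SH : S `<=` H) (HS : H `<=` generated S).
Hypothesis Spow : forall s, S s -> exists2 k, (0 < k)%N & H' (s ^+ k).

(** These are the elements whose class in the central factor of H is torsion modulo the image of H';
    being a subgroup, they can be tested on generators. *)
Definition power_mod i u := gam H i u /\ exists m v w,
  [/\ (0 < m)%N, gam H' i v, gam H i.+1 w & u ^+ m = v * w].

Let gH i u : gam H i u -> H u. Proof. exact: gam_sub. Qed.
Let gH' i u : gam H' i u -> H u. Proof. by move=> /(gam_sub sH')/H'H. Qed.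

Section WithQuotient.
Variables (i : nat) (Q : groupType) (pi : G -> Q).
Hypotheses (piM : morph_on H pi) (piK : forall x, H x -> (pi x = 1) <-> gam H i.+1 x).
Hypothesis piC : forall x y, gam H i x -> H y -> commute (pi x) (pi y).

Let power_modP u : gam H i u -> power_mod i u <->
  exists m v, [/\ (0 < m)%N, gam H' i v & pi u ^+ m = pi v].
Proof.
move=> gu; have Hu := gH gu; split=> [[_ [m [v [w [m0 gv gw e]]]]]|[m [v [m0 gv e]]]].
  exists m, v; split=> //; rewrite -(morph_onX sH piM)// e piM; [|exact: gH' gv|exact: gH gw].
  by rewrite ((piK (gH gw)).2 gw) mulg1.
split=> //; exists m, v, (v^-1 * u ^+ m); split=> //; last by rewrite mulVKg.
apply/(morph_on_eq sH piM piK); [exact: gH' gv|by grp|].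
by rewrite (morph_onX sH piM).
Qed.

Lemma power_mod_subgroup : subgroup (power_mod i).
Proof.
have sg := gam_subgroup i sH; have sg' := gam_subgroup i sH'.
apply: subgroup_intro.
- apply/power_modP; first exact: subg1.
  by exists 1%N, 1; split=> //; exact: subg1.
- move=> x y Px Py; have [gx gy] := (Px.1, Py.1); have [Hx Hy] := (gH gx, gH gy).
  move/(power_modP gx): Px => [m [v [m0 gv e]]]; move/(power_modP gy): Py => [n [w [n0 gw e']]].
  apply/power_modP; first by grp.
  have [Hv Hw] := (gH' gv, gH' gw).
  exists (m * n)%N, (v ^+ n * w ^+ m); split; [by rewrite muln_gt0 m0|by grp|].
  rewrite piM// expgMn ?piM ?(morph_onX sH piM)//; try by grp.
    by rewrite expgnA e mulnC expgnA e'.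
  exact: piC.
- move=> x Px; have gx := Px.1; have Hx := gH gx.
  move/(power_modP gx): Px => [m [v [m0 gv e]]].
  apply/power_modP; first by grp.
  exists m, v^-1; split=> //; first by grp.
  by rewrite !(morph_onV sH piM) ?expVgn ?e//; exact: gH' gv.
Qed.

Lemma power_mod_cong u u' : gam H i u -> power_mod i u' -> pi u = pi u' -> power_mod i u.
Proof.
move=> gu Pu' e; have gu' := Pu'.1; apply/(power_modP gu); rewrite e.
exact/(power_modP gu').
Qed.

End WithQuotient.

(** Induction on the weight: if a^m is v modulo deeper terms with v from H', and s^n is in H', then
    bilinearity gives [a, s]^(mn) = [v, s^n] modulo the next term. *)
Lemma gam_power_mod i u : gam H i u -> power_mod i u.
Proof.
elim: i u => [|i IH] u gu.
  have [Q [pi [piM piK piC]]] := gam_quotient 0 sH.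
  have := power_mod_subgroup piM piK piC => sP.
  apply: (generated_min sP _ (HS gu)) => s Ss; have [k k0 H's] := Spow Ss.
  split; first exact: SH.
  exists k, (s ^+ k), 1; split; rewrite ?mulg1//.
  exact: subg1 (gam_subgroup 1 sH).
have [Q [pi [piM piK piC]]] := gam_quotient i.+1 sH.
have sP := power_mod_subgroup piM piK piC.
apply: (generated_min sP _ gu) => _ [a ga [h Hh ->]].
have Ha := gH ga.
(* For fixed a the admissible second entries form a subgroup, so only entries from the generating
   set S remain to be treated. *)
pose R := [set h | H h /\ power_mod i.+1 [~ a, h]].
suff /(_ h Hh)[] : H `<=` R by [].
apply: subset_trans HS _; apply: generated_min.
  apply: subgroup_intro.
  - by split; [exact: subg1 | rewrite commg1; exact: subg1].
  - move=> x y [Hx Px] [Hy Py]; split; first by grp.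
    apply: (power_mod_cong piM piK (u' := [~ a, x] * [~ a, y])).
    + by apply: gamR => //; grp.
    + exact: subgM.
    + rewrite commgM_r (piM [~ a, y]) ?(piM [~ a, x]); try by grp.
      rewrite (morph_onJ sH piM); try by grp.
      have -> : pi [~ a, x] ^ pi y = pi [~ a, x].
        by apply/conjg_fixP/commgP; apply: piC => //; exact: gamR.
      by apply: piC; [exact: gamR|grp].
  - move=> x [Hx Px]; split; first by grp.
    apply: (power_mod_cong piM piK (u' := [~ a, x]^-1)).
    + by apply: gamR => //; grp.
    + exact: subgV.
    + have : [~ a, x * x^-1] = 1 by rewrite mulgV commg1.
      rewrite commgM_r => /(congr1 pi); rewrite piM; try by grp.
      rewrite (morph_onJ sH piM); try by grp.
      have -> : pi [~ a, x] ^ pi x^-1 = pi [~ a, x].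
        by apply/conjg_fixP/commgP; apply: piC; [exact: gamR|grp].
      rewrite (morph_on1 sH piM) [pi [~ a, x]^-1](morph_onV sH piM); try by grp.
      by move=> e; apply: (mulIg (pi [~ a, x])); rewrite e mulVg.
move=> s Ss; have Hs := SH Ss; split=> //.
have [_ [m [v [w [m0 gv gw e]]]]] := IH a ga; have [n n0 H's] := Spow Ss.
have [Hv Hw] := (gH' gv, gH gw).
have gas : gam H i.+1 [~ a, s] by exact: gamR.
have gvs : gam H' i.+1 [~ v, s ^+ n] by exact: gamR.
(* The last witness is the error term; it lies deeper because [w, s^n] does. *)
split=> //; exists (m * n)%N, [~ v, s ^+ n], ([~ v, s ^+ n]^-1 * [~ a, s] ^+ (m * n)).
split; [by rewrite muln_gt0 m0|exact: gvs| |by rewrite mulVKg].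
apply/(morph_on_eq sH piM piK); [exact: gH' gvs|by grp|].
have c1 x : H x -> commute (pi x) [~ pi a, pi s].
  by move=> Hx; rewrite -(morph_onR sH piM)//; apply: commute_sym; exact: piC.
rewrite (morph_onX sH piM); last by grp.
rewrite (morph_onR sH piM Ha Hs) expgnA -commgX_l; last exact: c1.
rewrite -commgX_r; last first.
  by rewrite commgX_l; [apply: commuteX; exact: c1|exact: c1].
rewrite -!(morph_onX sH piM)// -(morph_onR sH piM) ?e; try by grp.
rewrite commgM_l (piM ([~ v, s ^+ n] ^ w)); try by grp.
rewrite [pi [~ w, _]](piK _ _).2 ?mulg1; try by grp.
  rewrite (morph_onJ sH piM); try by grp.
  apply/esym/conjg_fixP/commgP; apply: piC => //.
  by apply: gamR; [exact: gam_mono gv | grp].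
by apply: gamR => //; grp.
Qed.

(** Each application of [gam_power_mod] to the error w pushes it one step down; w is central modulo
    the next term, so the power of v * w splits. *)
Lemma gam_power_upto i j u : gam H i u -> exists m v w,
  [/\ (0 < m)%N, gam H' i v, gam H (i + j).+1 w & u ^+ m = v * w].
Proof.
move=> gu; elim: j => [|j [m [v [w [m0 gv gw e]]]]].
  by have [_] := gam_power_mod gu; rewrite addn0.
have [_ [n [v' [w' [n0 gv' gw' e']]]]] := gam_power_mod gw.
have [Q [pi [piM piK piC]]] := gam_quotient (i + j).+1 sH.
have gv'i : gam H' i v' by apply: gam_le gv' => //; rewrite -addnS leq_addr.
have [Hu Hv Hw] := And3 (gH gu) (gH' gv) (gH gw).
have [Hv' Hw'] := (gH' gv', gH gw').
have sg' := gam_subgroup i sH'.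
exists (m * n)%N, (v ^+ n * v'), ((v ^+ n * v')^-1 * u ^+ (m * n)); split.
- by rewrite muln_gt0 m0.
- by grp.
- rewrite addnS; apply/(morph_on_eq sH piM piK); [by grp|by grp|].
  rewrite expgnA e (morph_onX sH piM); last by grp.
  rewrite !piM ?(morph_onX sH piM)//; try by grp.
  rewrite expgMn; last by apply: commute_sym; exact: piC.
  congr (_ * _); rewrite -(morph_onX sH piM)// e' piM//.
  by rewrite (_ : pi w' = 1) ?mulg1 //; apply/piK.
- by rewrite mulVKg.
Qed.

(* A commutator of weight i modulo weight i+1 is multilinear in its entries, so *)
(* suitable powers of all entries can be moved into [H'].                       *)
Lemma gam_power i u : gam H c `<=` [set 1] -> gam H i u ->
  exists2 m, (0 < m)%N & gam H' i (u ^+ m).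
Proof.
move=> gc gu; have [m [v [w [m0 gv gw e]]]] := gam_power_upto c gu.
exists m => //; rewrite e (gc w) ?mulg1//.
by apply: gam_le gw => //; rewrite -addnS addnC leqW// leq_addr.
Qed.

End Powers.

Lemma nilpotentP H : subgroup H -> nilpotent H <-> exists c, gam H c `<=` [set 1].
Proof.
move=> sH; split=> -[c e]; exists c; first by rewrite e.
by apply/seteqP; split=> // _ ->; exact: subg1 (gam_subgroup c sH).
Qed.

Lemma isolator_sub H A : subgroup H -> A `<=` H -> A `<=` isolator H A.
Proof. by move=> sH AH x Ax; split; [exact: AH | exists 1%N]. Qed.

(** The group generated by A, x and y is nilpotent and each generator has a power in A, so by
    [gam_power] at weight 0 every element of it has one. *)
Lemma isolator_subgroup H A : subgroup H -> nilpotent H -> subgroup A -> A `<=` H ->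
  subgroup (isolator H A).
Proof.
move=> sH /(nilpotentP sH)[c gc] sA AH; split.
  by apply: isolator_sub => //; exact: subg1.
move=> x y [Hx [k k0 Ax]] [Hy [l l0 Ay]]; split; first by grp.
pose S := A `|` [set x; y]; pose H0 := generated S.
have sH0 : subgroup H0 by exact: generated_subgroup.
have H0H : H0 `<=` H.
  by apply: generated_min => // z [/AH//|[->|->]].
have SH0 : S `<=` H0 by exact: sub_generated.
refine (@gam_power H0 A S c sH0 sA _ SH0 _ _ 0 (x / y) _ _) => //.
- by move=> z Az; apply: SH0; left.
- by move=> z [Az|[->|->]]; [exists 1%N|exists k|exists l].
- by apply: subset_trans gc; exact: gam_mono.
- by apply: (subgM sH0); [apply: SH0; right; left|apply: (subgV sH0); apply: SH0; right; right].
Qed.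

Section CentralModulo.
Variables (H B : set G) (c : nat).
Hypotheses (sH : subgroup H) (gc : gam H c `<=` [set 1]) (nB : normal_subgroup B H).
Hypothesis isoB : forall x k, H x -> (0 < k)%N -> B (x ^+ k) -> B x.

(** The preimages in H of the upper central series of H / B. *)
Fixpoint upper_central j : set G :=
  if j is j'.+1 then [set x | H x /\ forall y, H y -> upper_central j' [~ x, y]] else B.

Let Z := upper_central.

Lemma upper_central_normal j : normal_subgroup (Z j) H.
Proof.
elim: j => [//|j nZ].
have [Q [pi [piM piK]]] := quotient_group nZ; have [sZ _ ZH _] := nZ.
have ZP x : H x -> Z j.+1 x <-> forall y, H y -> commute (pi x) (pi y).
  move=> Hx; split=> [[_ h] y Hy|h].
    by apply/commgP; rewrite -(morph_onR sH piM)//; apply/eqP/piK; [grp|exact: h].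
  split=> // y Hy; apply/piK; first by grp.
  by rewrite (morph_onR sH piM)//; apply/eqP/commgP; exact: h.
split=> //; last 2 first.
- by move=> x [].
- move=> b a Hb Za; have Ha := Za.1; apply/ZP; first by grp.
  move=> y Hy; rewrite /iota !piM//; try by grp.
  have /(ZP _ Ha) aC := Za; rewrite -(aC b Hb) -mulgA -piM; try by grp.
  by rewrite mulgV (morph_on1 sH piM) mulg1; exact: aC.
apply: subgroup_intro.
- apply/ZP; first exact: subg1.
  by move=> y _; rewrite (morph_on1 sH piM); apply: commute_sym; exact: commute1.
- move=> x y Zx Zy; have [Hx Hy] := (Zx.1, Zy.1); apply/ZP; first by grp.
  move=> z Hz; rewrite piM//; apply: commute_sym; apply: commuteM; apply: commute_sym.
    by move/(ZP _ Hx): Zx; exact.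
  by move/(ZP _ Hy): Zy; exact.
- move=> x Zx; have Hx := Zx.1; apply/ZP; first by grp.
  move=> y Hy; rewrite (morph_onV sH piM)//; apply: commute_sym; apply: commuteV.
  by apply: commute_sym; move/(ZP _ Hx): Zx; exact.
Qed.

Lemma upper_central_incr j : Z j `<=` Z j.+1.
Proof.
move=> x Zx; have [sZ _ ZH _] := upper_central_normal j; split; first exact: ZH.
move=> y Hy; rewrite commgEl; apply: subgM => //; first exact: subgV.
exact: normalJ (upper_central_normal j) Zx Hy.
Qed.

Lemma upper_central_le i j : (i <= j)%N -> Z i `<=` Z j.
Proof.
elim: j => [|j IH]; first by rewrite leqn0 => /eqP->.
by rewrite leq_eqVlt => /predU1P[->//|/IH le]; exact: subset_trans le (@upper_central_incr j).
Qed.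

Lemma gam_upper_central j : (j <= c)%N -> gam H (c - j) `<=` Z j.
Proof.
elim: j => [|j IH] jc x gx.
  by rewrite subn0 in gx; rewrite (gc gx); apply: subg1; have [] := nB.
split; first exact: gam_sub gx.
move=> y Hy; apply: (IH (ltnW jc)); rewrite -(subnSK jc); exact: gamR.
Qed.

(** Torsion-freeness of H / B passes up to the factors of its upper central series: modulo Z j, the
    commutator [x, y] commutes with x, so its k-th power is [x^k, y]. *)
Lemma upper_central_isolated j x k : (0 < k)%N -> Z j.+1 x -> Z j (x ^+ k) -> Z j x.
Proof.
move=> k0; elim: j x => [|j IH] x Zx Zxk; first by apply: isoB Zxk => //; have [] := Zx.
have Hx := Zx.1; split=> // y Hy; apply: IH; first exact: (Zx.2 y Hy).
have nZ := upper_central_normal j; have [Q [pi [piM piK]]] := quotient_group nZ.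
apply/piK; first by grp.
rewrite (morph_onX sH piM) ?(morph_onR sH piM)//; try by grp.
rewrite -commgX_l; last first.
  apply: commute_sym; apply/commgP; rewrite -!(morph_onR sH piM)//; try by grp.
  by apply/eqP/piK; [grp|apply: ((Zx.2 y Hy).2)].
rewrite -(morph_onX sH piM)// -(morph_onR sH piM)//; try by grp.
by apply/piK; [grp|exact: (Zxk.2 y Hy)].
Qed.

(** By nilpotency x lies in Z c; as x^k already lies in Z 1, [upper_central_isolated] brings x down
    to Z 1 one step at a time. *)
Lemma central_root x k : (0 < k)%N -> H x -> (forall y, H y -> B [~ x ^+ k, y]) ->
  forall y, H y -> B [~ x, y].
Proof.
move=> k0 Hx xkB; have Zxk : Z 1 (x ^+ k) by split=> //; grp.
have Zc : Z c x by apply: (@gam_upper_central c) => //; rewrite subnn.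
suff : Z 1 x by case.
have [/upper_central_le/(_ x Zc)//|] := leqP c 1.
move=> /ltnW; case: c Zc => // c' Zc _; elim: c' Zc => [//|c' IH] Zc; apply: IH.
by apply: (upper_central_isolated k0 Zc); apply: upper_central_le Zxk.
Qed.

End CentralModulo.

End LowerCentral.

(** * Free abelian quotients in coordinates *)

Section Zpow.
Variable G : groupType.
Implicit Types (x y : G) (A : set G).
Local Open Scope group_scope.

Definition zpow x (c : int) : G := if c is Negz k then x ^- k.+1 else x ^+ `|c|%N.

Lemma zpowD x (a b : int) : zpow x (a + b)%R = zpow x a * zpow x b.
Proof.
have S1 c : zpow x (c + 1)%R = zpow x c * x.
  case: c => [n|[|n]]; first by rewrite -PoszD addn1 /= expgSr.
    by rewrite NegzE addNr /= expg0 expg1 mulVg.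
  have -> : (Negz n.+1 + 1)%R = Negz n by rewrite !NegzE -(addn1 n.+1) PoszD opprD addrNK.
  by rewrite /= [in RHS]expgS invgM mulgVK.
have P1 c : zpow x (c - 1)%R = zpow x c * x^-1.
  by rewrite -{2}(subrK 1%R c) S1 mulgK.
elim/int_rect: b => [|n IH|n IH]; first by rewrite addr0 /= expg0 mulg1.
  by rewrite -addn1 PoszD addrA !S1 IH mulgA.
by rewrite -addn1 PoszD opprD addrA !P1 IH mulgA.
Qed.

Lemma zpowN x (a : int) : zpow x (- a)%R = (zpow x a)^-1.
Proof. by apply: (mulIg (zpow x a)); rewrite -zpowD addNr mulVg. Qed.

Lemma zpow_sub A x c : subgroup A -> A x -> A (zpow x c).
Proof. by move=> sA Ax; case: c => n /=; [exact: subgX | apply: subgV => //; exact: subgX]. Qed.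

End Zpow.

Lemma morph_zpow (G Q : groupType) (A : set G) (f : G -> Q) x c :
  subgroup A -> morph_on A f -> A x -> f (zpow x c) = zpow (f x) c.
Proof.
move=> sA fM Ax; case: c => n; rewrite /zpow ?(morph_onV sA fM) ?(morph_onX sA fM)//.
by grp.
Qed.


Section Additive.
Variables (G : groupType) (V : zmodType) (A : set G) (f : G -> V).
Hypotheses (sA : subgroup A) (fD : forall x y, A x -> A y -> f (x * y)%g = f x + f y).

Lemma add_on1 : f 1%g = 0.
Proof. by apply: (addrI (f 1%g)); rewrite -fD ?mulg1 ?addr0//; exact: subg1. Qed.
Lemma add_onV x : A x -> f x^-1%g = - f x.
Proof. by move=> Ax; apply: (addIr (f x)); rewrite -fD ?mulVg ?add_on1 ?addNr//; exact: subgV. Qed.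
Lemma add_onX x k : A x -> f (x ^+ k)%g = f x *+ k.
Proof.
move=> Ax; elim: k => [|k IH]; first by rewrite expg0 mulr0n add_on1.
by rewrite expgS mulrS fD ?IH//; exact: subgX.
Qed.
Lemma add_onJ x y : A x -> A y -> f (x ^ y)%g = f x.
Proof.
move=> Ax Ay; rewrite conjgE !fD ?add_onV//; first by rewrite addrCA addNr addr0.
- exact: subgV.
- exact: subgM.
Qed.
Lemma add_onR x y : A x -> A y -> f [~ x, y]%g = 0.
Proof.
move=> Ax Ay; rewrite commgEl fD ?add_onV ?add_onJ ?addNr//; [exact: subgV|exact: subgJ].
Qed.
End Additive.

Section QuotientIso.
Variable G : groupType.
Implicit Types (A B : set G) (x y : G).

Definition isolated B A := forall x k, A x -> (0 < k)%N -> B (x ^+ k)%g -> B x.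

Lemma quotient_isoB A B n (p : G -> 'rV[int]_n) : quotient_iso A B p ->
  forall x, A x -> (p x = 0) <-> B x.
Proof. by case=> _ _ <- x Ax; split=> [px|[]]. Qed.

Lemma quotient_iso_surj A B n (p : G -> 'rV[int]_n) v : quotient_iso A B p ->
  exists2 x, A x & p x = v.
Proof. by case=> _ pA _; have : [set: 'rV[int]_n] v by []; rewrite -pA => -[x]; exists x. Qed.

Lemma quotient_iso_isolated A B n (p : G -> 'rV[int]_n) : subgroup A ->
  quotient_iso A B p -> isolated B A.
Proof.
move=> sA pP x k Ax k0; have [pD _ _] := pP.
rewrite -(quotient_isoB pP); last exact: subgX.
rewrite -(quotient_isoB pP)// (add_onX sA pD)// => /rowP px.
apply/rowP => i; have := px i; rewrite mulmxnE !mxE => /eqP.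
by rewrite mulrn_eq0 (gtn_eqF k0) => /eqP.
Qed.

(** The rows of J are the values of q at preimages of the basis vectors; every vector then has some
    preimage obeying the formula, and two preimages differ by an element of B. *)
Lemma quotient_iso_factor A B n (p : G -> 'rV[int]_n) m (q : G -> 'rV[int]_m) :
  subgroup A -> quotient_iso A B p ->
  (forall x y, A x -> A y -> q (x * y)%g = q x + q y) ->
  (forall x, B x -> q x = 0) ->
  exists J : 'M[int]_(n, m), forall x, A x -> q x = p x *m J.
Proof.
move=> sA pP qD qB; have [pD _ _] := pP.
have /boolp.choice[e eP] (i : 'I_n) : exists x, A x /\ p x = delta_mx 0 i.
  by have [x] := quotient_iso_surj (delta_mx 0 i) pP; exists x.
pose J := \matrix_(i, j) q (e i) 0 j; exists J.
pose good v := exists y, [/\ A y, p y = v & q y = v *m J].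
have good0 : good 0.
  by exists 1%g; rewrite mul0mx; split; [exact: subg1|exact: add_on1 pD|exact: add_on1 qD].
have goodD v w : good v -> good w -> good (v + w).
  move=> [x [Ax px qx]] [y [Ay py qy]]; exists (x * y)%g; split; first exact: subgM.
    by rewrite pD// px py.
  by rewrite qD// qx qy mulmxDl.
have goodN v : good v -> good (- v).
  move=> [x [Ax px qx]]; exists (x^-1)%g; split; first exact: subgV.
    by rewrite (add_onV sA pD)// px.
  by rewrite (add_onV sA qD)// qx mulNmx.
have goodZ (c : int) v : good v -> good (c *: v).
  move=> gv; elim/int_rect: c => [|k IH|k IH]; first by rewrite scale0r.
    by rewrite intS scalerDl scale1r; exact: goodD.
  by rewrite intS opprD scalerDl scaleN1r; apply: goodD => //; exact: goodN.
have good_all v : good v.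
  rewrite (row_sum_delta v); elim/big_ind: _ => // i _; apply: goodZ.
  have [Ae pe] := eP i; exists (e i); split=> //; rewrite -rowE.
  by apply/rowP => j; rewrite !mxE.
move=> x Ax; have [y [Ay py <-]] := good_all (p x).
have Bxy : B (x * y^-1)%g.
  rewrite -(quotient_isoB pP); last by grp.
  by rewrite pD ?(add_onV sA pD) ?py ?subrr//; exact: subgV.
have := qB _ Bxy; rewrite qD ?(add_onV sA qD)//; last exact: subgV.
by move/eqP; rewrite subr_eq0 => /eqP.
Qed.

Lemma induced_matrix_exists A B n (p : G -> 'rV[int]_n) (f : G -> G) :
  subgroup A -> quotient_iso A B p -> morph_on A f ->
  (forall x, A x -> A (f x)) -> (forall x, B x -> B (f x)) ->
  exists M, induced_matrix A p f M.
Proof.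
move=> sA pP fM fA fB; have [pD _ pB] := pP.
apply: (quotient_iso_factor (q := p \o f) sA pP) => [x y Ax Ay|x Bx] /=.
  by rewrite fM// pD//; exact: fA.
have Ax : A x by move: Bx; rewrite -pB => -[].
by apply/(quotient_isoB pP); [exact: fA|exact: fB].
Qed.

Lemma induced_matrix_uniq A B n (p : G -> 'rV[int]_n) (f : G -> G) M M' :
  quotient_iso A B p -> induced_matrix A p f M -> induced_matrix A p f M' -> M = M'.
Proof.
move=> pP fM fM'; apply/row_matrixP => i; rewrite !rowE.
by have [x Ax <-] := quotient_iso_surj (delta_mx 0 i) pP; rewrite -fM// -fM'.
Qed.

(** The inclusion of A' in A induces an injective J with cokernel of finite exponent and J M = M' J.
    Hence J is square with nonzero determinant, which cancels from J (1 - M) = (1 - M') J. *)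
Lemma det_sub1_commensurable A B A' n (p : G -> 'rV[int]_n) n' (p' : G -> 'rV[int]_n') f M M' :
  subgroup A -> subgroup A' -> A' `<=` A ->
  (forall x, A x -> exists2 k, (0 < k)%N & A' (x ^+ k)%g) ->
  quotient_iso A B p -> quotient_iso A' (B `&` A') p' ->
  (forall x, A' x -> A' (f x)) ->
  induced_matrix A p f M -> induced_matrix A' p' f M' ->
  \det (1%:M - M) = \det (1%:M - M').
Proof.
move=> sA sA' A'A pow pP pP' fA' fM fM'.
have [pD _ _] := pP; have [pD' _ _] := pP'.
have [J pJ] : exists J : 'M_(n', n), forall x, A' x -> p x = p' x *m J.
  apply: (quotient_iso_factor sA' pP').
    by move=> x y /A'A Ax /A'A Ay; exact: pD.
  by move=> x [Bx /A'A Ax]; apply/(quotient_isoB pP).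
have JM : J *m M = M' *m J.
  apply/row_matrixP => i; rewrite !rowE !mulmxA.
  have [x A'x <-] := quotient_iso_surj (delta_mx 0 i) pP'.
  by rewrite -(pJ x A'x) -(fM x (A'A x A'x)) (pJ _ (fA' x A'x)) (fM' x A'x).
have Jinj (v : 'rV_n') : v *m J = 0 -> v = 0.
  have [x A'x <-] := quotient_iso_surj v pP'; rewrite -pJ// => px.
  by apply/(quotient_isoB pP') => //; split=> //; apply/(quotient_isoB pP) => //; exact: A'A.
have /boolp.choice[e eP] (i : 'I_n) : exists e : G * nat,
    [/\ A e.1, p e.1 = delta_mx 0 i, (0 < e.2)%N & A' (e.1 ^+ e.2)%g].
  have [x Ax px] := quotient_iso_surj (delta_mx 0 i) pP.
  by have [k k0 A'x] := pow x Ax; exists (x, k).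
pose k := (\prod_i (e i).2)%N.
have k0 : (0 < k)%N by rewrite prodn_gt0// => i; have [] := eP i.
have A'k i : A' ((e i).1 ^+ k)%g.
  by have [_ _ _ h] := eP i; rewrite /k (bigD1 i)//= expgnA; exact: subgX.
(* [J'] inverts [J] up to the scalar [k], so comparing traces gives n = n'. *)
pose J' := \matrix_(i, j) p' ((e i).1 ^+ k)%g 0 j.
have J'J : J' *m J = (k%:R)%:M.
  apply/row_matrixP => i; have [Ae pe _ _] := eP i.
  have -> : row i (J' *m J) = p' ((e i).1 ^+ k)%g *m J.
    by rewrite row_mul; congr (_ *m _); apply/rowP => j; rewrite !mxE.
  rewrite -pJ// (add_onX sA pD)// pe; apply/rowP => j.
  by rewrite mulmxnE !mxE eqxx/= eq_sym mulrnAC.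
have JJ' : J *m J' = (k%:R)%:M.
  apply/row_matrixP => i; apply/eqP; rewrite -subr_eq0 -linearB/= rowE; apply/eqP.
  by apply: Jinj; rewrite -mulmxA mulmxBl -mulmxA J'J scalar_mxC subrr mulmx0.
have nn' : n = n'.
  have := mxtrace_mulC J' J; rewrite J'J JJ' !mxtrace_scalar -!mulrnA => /eqP.
  by rewrite eqr_nat eqn_pmul2l// => /eqP.
subst n'; have dJ : \det J != 0.
  apply/eqP => dJ; have : \det (J' *m J) = 0 by rewrite det_mulmx dJ mulr0.
  by rewrite J'J det_scalar => /eqP; rewrite expf_eq0 pnatr_eq0 (gtn_eqF k0) andbF.
apply: (mulfI dJ); rewrite -det_mulmx [RHS]mulrC -det_mulmx.
by rewrite mulmxBr mulmxBl mulmx1 mul1mx JM.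
Qed.

(** Independence of the coordinates is the case A' = A of [det_sub1_commensurable]. *)
Lemma quotient_detE A B n (p : G -> 'rV[int]_n) f M :
  subgroup A -> quotient_iso A B p -> (forall x, A x -> A (f x)) -> induced_matrix A p f M ->
  quotient_det A B f = \det (1%:M - M).
Proof.
move=> sA pP fA fM; rewrite /quotient_det; set D := [set d | _].
case: (xgetPex 0 (P := D)); first by exists (\det (1%:M - M)), n, p, M.
move=> n' [p' [M' [pP' fM' ->]]]; refine (det_sub1_commensurable sA sA _ _ pP' _ fA fM' fM) => //.
  by move=> x Ax; exists 1%N.
by rewrite (_ : B `&` A = B)//; apply/seteqP; split=> [x []//|x Bx]; split=> //;
  case: pP Bx => _ _ <- [].
Qed.

End QuotientIso.

Lemma zpowA (G : groupType) (x : G) (a b : int) : zpow x (a * b) = zpow (zpow x a) b.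
Proof.
elim/int_rect: b => [|n IH|n IH]; first by rewrite mulr0 /= !expg0.
  by rewrite intS mulrDr mulr1 !zpowD IH.
by rewrite intS opprD mulrDr mulrN1 !zpowD IH !zpowN.
Qed.

Section FreeAbelianSections.
Variable G : groupType.
Implicit Types (A B C N : set G) (x y g : G).
Local Open Scope group_scope.

(** A subgroup of a cyclic group is generated by the least positive exponent occurring in it, by
    division with remainder. If no positive exponent occurs, C lies in B and x = 1 works. *)
Lemma cyclic_quotientI A B C : normal_subgroup B A -> cyclic_quotient A B ->
  subgroup C -> C `<=` A ->
  exists2 x, C x & forall y, C y -> exists c : int, B ((zpow x c)^-1 * y).
Proof.
move=> nBA [g Ag gA] sC CA; have [sB sA _ _] := nBA.
have [Q [pi [piM piK]]] := quotient_group nBA.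
have {}gA y : A y -> exists c : int, pi y = zpow (pi g) c.
  move=> Ay; have [k [e|e]] := gA y Ay.
    exists (Posz k); rewrite -(morph_zpow _ sA piM)//; apply/(morph_on_eq sA piM piK) => //.
      exact: zpow_sub.
    exact/lcoset_eq.
  exists (- Posz k)%R; rewrite -(morph_zpow _ sA piM)//; apply/(morph_on_eq sA piM piK) => //.
    exact: zpow_sub.
  by apply/lcoset_eq => //; rewrite zpowN.
pose I c := exists2 y, C y & pi y = zpow (pi g) c.
have [[d [d0 Id]]|I0] := pselect (exists d : nat, (0 < d)%N /\ I d); last first.
  exists 1; first exact: subg1.
  move=> y Cy; have [c e] := gA y (CA _ Cy); exists 0%R.
  rewrite [zpow _ _]expg0 invg1 mul1g; apply/piK; first exact: CA.
  rewrite e; case: c e => [[|n]|n] e; first exact: expg0.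
    by case: I0; exists n.+1; split=> //; exists y.
  case: I0; exists n.+1; split=> //; exists y^-1; first exact: subgV.
  by rewrite (morph_onV sA piM) ?e ?invgK//; exact: CA.
have exd : exists d : nat, (0 < d)%N && `[< I d >] by exists d; rewrite d0; apply/asboolP.
move: (ex_minnP exd) => -[{exd Id d0}d /andP[d0 /asboolP[x Cx xd]] dmin].
exists x => // y Cy; have [c e] := gA y (CA _ Cy).
exists (c %/ d)%Z; have Ax := CA _ Cx; have Ay := CA _ Cy.
have Cz : C (zpow x (c %/ d)%Z) by exact: zpow_sub.
apply/piK; first by apply: subgM => //; apply: subgV => //; exact: CA.
have pir : pi ((zpow x (c %/ d)%Z)^-1 * y) = zpow (pi g) (c %% d)%Z.
  rewrite piM ?(morph_onV sA piM) ?(morph_zpow _ sA piM)//; try exact: CA.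
    rewrite xd -zpowA e {2}(divz_eq c d) zpowD mulrC mulKg//.
  by apply: subgV => //; exact: CA.
have r0 : (0 <= (c %% d)%Z)%R by rewrite modz_ge0// -lt0n.
have rd : ((c %% d)%Z < d)%R by apply: ltz_pmod.
rewrite pir; case: (c %% d)%Z r0 rd pir => // [[|r]] _ rd pir; first by rewrite [LHS]expg0.
have /dmin : (0 < r.+1)%N && `[< I r.+1 >].
  by apply/andP; split=> //; apply/asboolP; eexists; last exact: pir; grp.
by rewrite leqNgt (_ : (r.+1 < d)%N).
Qed.

(** Only a surjection of Z^n onto pi(A), given by lifts to A; injectivity comes later from the
    minimality of n. *)
Definition coordinates (Q : groupType) (pi : G -> Q) A n (e : 'rV[int]_n -> G) : Prop :=
  [/\ forall v, A (e v), forall v w, pi (e (v + w)%R) = pi (e v) * pi (e w)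
    & forall x, A x -> exists v, pi x = pi (e v)].

(** Climbing the polycyclic series from the bottom, each cyclic factor contributes one
    coordinate. *)
Lemma polycyclic_coordinates N A (Q : groupType) (pi : G -> Q) :
  polycyclic N -> subgroup A -> A `<=` N -> morph_on A pi ->
  (forall x y, A x -> A y -> commute (pi x) (pi y)) ->
  exists n (e : 'rV[int]_n -> G), coordinates pi A e.
Proof.
move=> [n [S [S0 Sn SS]]] sA AN piM piC.
suff H d : (d <= n)%N -> exists m (e : 'rV[int]_m -> G), coordinates pi (A `&` S (n - d)%N) e.
  by have := H n (leqnn n); rewrite subnn S0 setIidl.
elim: d => [|d IH] dn.
  rewrite subn0 Sn; exists 0%N, (fun=> 1); split=> [_|_ _|x [_ ->]].
  - by split=> //; exact: subg1.
  - by rewrite (morph_on1 sA piM) mulg1.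
  - by exists 0%R.
have [m [e [eA eD eS]]] := IH (ltnW dn).
have jn : (n - d.+1 < n)%N by rewrite ltn_subrL (leq_trans _ dn).
have [nS cS] := SS _ jn; rewrite (subnSK dn) in nS cS.
have [sS' sS S'S _] := nS.
set S' := S (n - d)%N in nS cS sS' S'S eA eS *; set T := S _ in nS cS sS S'S *.
have [x [Ax Tx] xP] := cyclic_quotientI nS cS (subgroupI sA sS) (@subIsetr _ _ _).
exists (1 + m)%N, (fun v => zpow x (lsubmx v 0 0) * e (rsubmx v)).
have Ae v : A (e v) by have [] := eA v.
have Ax' c : A (zpow x c) by exact: zpow_sub.
split=> [v|v w|y [Ay Ty]].
- split; first by grp.
  by apply: subgM => //; [exact: zpow_sub | apply: S'S; have [] := eA (rsubmx v)].
- rewrite !piM// !linearD/= eD mxE zpowD piM//.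
  by rewrite -!mulgA; congr (_ * _); rewrite !mulgA; congr (_ * _); exact: piC.
- have [c S'y] := xP y (conj Ay Ty).
  have Ay' : A ((zpow x c)^-1 * y) by grp.
  have [v pv] := eS _ (conj Ay' S'y).
  exists (row_mx (const_mx c) v); rewrite row_mxKl row_mxKr mxE piM// -pv -piM//.
  by rewrite mulVKg.
Qed.

(** A finitely generated torsion-free abelian group is free: with the fewest possible generators
    there are no relations. Isolation of B is the torsion-freeness. *)
Lemma free_abelian_quotient N A B : polycyclic N -> subgroup A -> A `<=` N ->
  normal_subgroup B A -> (forall x y, A x -> A y -> B [~ x, y]) -> isolated B A ->
  exists n (p : G -> 'rV[int]_n), quotient_iso A B p.
Proof.
move=> pN sA AN nB abB iB; have [sB _ BA _] := nB.
have [Q [pi [piM piK]]] := quotient_group nB.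
have piC x y : A x -> A y -> commute (pi x) (pi y).
  move=> Ax Ay; apply/commgP; rewrite -(morph_onR sA piM)//; apply/eqP/piK; first by grp.
  exact: abB.
have ex0 := polycyclic_coordinates pN sA AN piM piC.
have ex : exists n, `[< exists e : 'rV[int]_n -> G, coordinates pi A e >].
  by case: ex0 => n [e]; exists n; apply/asboolP; exists e.
have [n /asboolP[e [eA eD eS]] nmin] := ex_minnP ex.
have e0 : pi (e 0%R) = 1 by apply: (mulgI (pi (e 0%R))); rewrite -eD addr0 mulg1.
have eN v : pi (e (- v)%R) = (pi (e v))^-1.
  by apply: (mulIg (pi (e v))); rewrite -eD addNr e0 mulVg.
have eZ v (c : nat) : pi (e (v *+ c)%R) = pi (e v) ^+ c.
  by elim: c => [|c IH]; rewrite ?mulr0n ?e0 ?expg0// mulrS eD IH expgS.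
(* By Smith normal form, a relation [v] would be a nonzero multiple of a basis    *)
(* vector, whose image is then trivial and could be dropped.                      *)
have einj v : pi (e v) = 1 -> v = 0%R.
  move=> ev; apply/eqP; apply: contrapT => /negP v0.
  case: n e eA eD eS nmin e0 eN eZ v ev v0 => [|n] e eA eD eS nmin e0 eN eZ v ev v0.
    by move/eqP: v0; apply; apply/matrixP => ? [].
  have [L uL [R uR [d _ vE]]] := int_Smith_normal_form v.
  set D := (X in L *m X) in vE.
  have DE : D = d`_0 *: delta_mx 0 0.
    by apply/matrixP => i j; rewrite !mxE !ord1 eqxx/= mulr_natr eq_sym.
  (* Here v = c u, where u is the first row of the unimodular R, hence a basis vector, and c is not
     0. *)
  pose c := (L 0 0 * d`_0)%R.
  have vE' : v = c *: (delta_mx 0 0 *m R).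
    by rewrite vE DE [L]mx11_scalar -scalemxAr -scalemxAl mul_scalar_mx -scalemxAl scalerA mulrC.
  have c0 : c != 0%R by apply: contraNneq v0 => c0; rewrite vE' c0 scale0r.
  pose u : 'rV[int]_n.+1 := delta_mx 0 0 *m R.
  have eu : pi (e u) = 1.
    have Bu k : (0 < k)%N -> pi (e (u *+ k)%R) = 1 -> pi (e u) = 1.
      move=> k0; rewrite eZ -(morph_onX sA piM)// => /piK => Bk.
      by apply/piK => //; apply: iB k0 (Bk _) => //; exact: subgX.
    move: ev; rewrite vE' -/u; case: (c) c0 => [[|k]|k] // _.
      by rewrite -natz scaler_nat; exact: Bu.
    by rewrite NegzE scaleNr eN -natz scaler_nat => /eqP; rewrite invg_eq1 => /eqP; exact: Bu.
  suff /nmin : `[< exists e : 'rV[int]_n -> G, coordinates pi A e >] by rewrite ltnn.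
  pose emb (w : 'rV[int]_n) : 'rV[int]_n.+1 := row_mx (0 : 'rV_1) w.
  have embD w w' : emb (w + w')%R = (emb w + emb w')%R 
    by apply/rowP => j; rewrite !mxE; case: splitP => k _; rewrite !mxE ?addr0.
  apply/asboolP; exists (fun w => e (emb w *m R)); split=> [w|w w'|x Ax].
  - exact: eA.
  - by rewrite embD mulmxDl eD.
  (* In the basis of rows of R the first coordinate multiplies u, whose image is trivial; the other
     n coordinates suffice. *)
  - have [w ->] := eS x Ax; pose w1 : 'rV[int]_(1 + n) := w *m invmx R.
    exists (rsubmx w1).
    have -> : w = (w1 0 0 *: u + emb (rsubmx w1) *m R)%R.
      rewrite /u scalemxAl -mulmxDl -[LHS](mulmxKV uR); congr (_ *m _).
      rewrite -/w1 -{1}[w1]hsubmxK /emb; apply/rowP => j; rewrite !mxE eqxx/=.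
      case: splitP => k jk; rewrite !mxE.
        have -> : j = 0 by apply: val_inj; rewrite /= jk ord1.
        by rewrite mulr1 addr0 ord1 (_ : lshift n ord0 = 0)//; apply: val_inj.
      have -> : (j == 0) = false by apply/eqP => j0; move: jk; rewrite j0.
      by rewrite mulr0 add0r.
    rewrite eD; suff -> : pi (e (w1 0 0 *: u)%R) = 1 by rewrite mul1g.
    case: (w1 0 0) => k; first by rewrite -natz scaler_nat eZ eu expg1n.
    by rewrite NegzE scaleNr eN -natz scaler_nat eZ eu expg1n invg1.
have /boolp.choice[p pP] (x : G) : exists v, A x -> pi x = pi (e v).
  by have [/eS[v]|nA] := pselect (A x); [exists v | exists 0%R].
have inj v w : pi (e v) = pi (e w) -> v = w.
  move=> evw; apply/eqP; rewrite -subr_eq0; apply/eqP/einj.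
  by rewrite eD eN evw mulgV.
exists n, p; split=> [x y Ax Ay||].
- by apply: inj; rewrite -pP ?eD -?pP//; [exact: piM | grp].
- by apply/seteqP; split=> // v _; exists (e v) => //; apply: inj; rewrite -pP.
- apply/seteqP; split=> [x [Ax px]|x Bx].
    by apply/piK => //; rewrite pP// px.
  by split; [exact: BA|]; apply: einj; rewrite -pP; [apply/piK => //|]; exact: BA.
Qed.

End FreeAbelianSections.

(** * NR-groups *)

Section DerivedIsolator.
Variable G : groupType.
Implicit Types (A B D N : set G) (x y g : G).
Local Open Scope group_scope.

Lemma normal_of_commutators B D : subgroup D -> subgroup B -> B `<=` D ->
  (forall x y, B x -> D y -> B [~ x, y]) -> normal_subgroup B D.
Proof.
move=> sD sB BD BR; split=> // b a Db Ba; rewrite iotaE.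
have -> : a ^ b^-1 = a * [~ a, b^-1] by rewrite commgEl mulVKg.
by apply: subgM => //; apply: BR => //; exact: subgV.
Qed.

Variable D : set G.
Hypothesis sD : subgroup D.
Let H := derived_isolator D.
Let C := commutator D D.

Let nC : normal_subgroup C D.
Proof. exact: (gam_normal 1 sD). Qed.

Lemma derived_isolator_comm x y : D x -> D y -> H [~ x, y].
Proof. by move=> Dx Dy; split; [grp | exists 1%N => //; exact: commutatorS]. Qed.

Lemma derived_isolator_sub : H `<=` D. Proof. by move=> x []. Qed.

(** D need not be nilpotent, so [isolator_subgroup] does not apply; instead, the torsion elements of
    the abelian group D / [D, D] form a subgroup. *)
Lemma derived_isolator_subgroup : subgroup H.
Proof.
have [sC _ CD _] := nC; have [Q [pi [piM piK]]] := quotient_group nC.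
have piC x y : D x -> D y -> commute (pi x) (pi y).
  move=> Dx Dy; apply/commgP; rewrite -(morph_onR sD piM)//; apply/eqP/piK; first by grp.
  exact: commutatorS.
split; first by split; [exact: subg1 | exists 1%N => //; rewrite expg1; exact: subg1].
move=> x y [Dx [k k0 Cx]] [Dy [l l0 Cy]]; split; first by grp.
exists (k * l)%N; first by rewrite muln_gt0 k0.
apply/piK; first by grp.
rewrite (morph_onX sD piM) ?piM ?(morph_onV sD piM)//; try by grp.
rewrite expgnFl; last exact: piC.
have px : pi x ^+ k = 1 by rewrite -(morph_onX sD piM)//; apply/piK => //; grp.
have py : pi y ^+ l = 1 by rewrite -(morph_onX sD piM)//; apply/piK => //; grp.
by rewrite {1}expgnA px mulnC expgnA py !expg1n divg1.
Qed.

Lemma derived_isolator_normal : normal_subgroup H D.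
Proof.
apply: normal_of_commutators => // [||x y [Dx _] Dy].
- exact: derived_isolator_subgroup.
- exact: derived_isolator_sub.
- exact: derived_isolator_comm.
Qed.

Lemma derived_isolator_isolated : isolated H D.
Proof.
move=> x k Dx k0 [_ [l l0 Cx]]; split=> //; exists (k * l)%N; first by rewrite muln_gt0 k0.
by rewrite expgnA.
Qed.

End DerivedIsolator.

Lemma derived_isolatorS (G : groupType) (D N : set G) : subgroup N -> D `<=` N ->
  derived_isolator D `<=` derived_isolator N.
Proof.
move=> sN DN x [Dx [k k0 Cx]]; split; first exact: DN.
by exists k => //; apply: (@gam_mono _ N D 1) Cx.
Qed.

Section NRGroup.
Variables (G : groupType) (N : set G).
Implicit Types (A B D : set G) (x y g : G).
Local Open Scope group_scope.
Hypotheses (sN : subgroup N) (nrN : NR_group N).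

Lemma NR_polycyclic : polycyclic N. Proof. by case: nrN => -[]. Qed.

Variables (c : nat) (S : nat -> set G).
Hypothesis S1 : S 1%N = derived_isolator N.
Hypothesis Sc : S c.+1 = [set 1].
Hypothesis nS : forall i, (0 < i <= c.+1)%N -> normal_subgroup (S i) N.
Hypothesis SS : forall i, (0 < i <= c)%N ->
  [/\ S i.+1 `<=` S i, commutator (S i) (derived_isolator N) `<=` S i.+1,
      exists (n : nat) (p : G -> 'rV[int]_n), quotient_iso (S i) (S i.+1) p
    & forall g, N g -> only_trivial_unity_eigenvalue (S i) (S i.+1) (iota g)].

Let sS i : (i <= c)%N -> subgroup (S i.+1).
Proof. by move=> ic; have [] := @nS i.+1 ic. Qed.

Lemma NR_gam D i : subgroup D -> D `<=` N -> (i <= c)%N ->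
  lower_central (derived_isolator D) i.+1 `<=` S i.+1.
Proof.
move=> sD DN; elim: i => [|i IH] ic; first by rewrite S1; exact: derived_isolatorS.
have [_ SR _ _] := @SS i.+1 ic.
apply: commutator_min; first exact: sS.
move=> x y gx Hy; apply: SR; apply: commutatorS; first exact: (IH (ltnW ic)).
exact: derived_isolatorS Hy.
Qed.

Lemma NR_nilpotent D : subgroup D -> D `<=` N -> nilpotent (derived_isolator D).
Proof.
move=> sD DN; apply/nilpotentP; first exact: derived_isolator_subgroup.
by exists c; rewrite -Sc; exact: NR_gam.
Qed.

Lemma NR_torsion_free x k : (0 < k)%N -> derived_isolator N x -> x ^+ k = 1 -> x = 1.
Proof.
move=> k0 Hx xk; suff H i : (i <= c)%N -> S i.+1 x by have := H c (leqnn c); rewrite Sc.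
elim: i => [|i IH] ic; first by rewrite S1.
have [_ _ [n [p pP]] _] := @SS i.+1 ic.
apply: (quotient_iso_isolated (sS (ltnW ic)) pP _ k0); first exact: (IH (ltnW ic)).
by rewrite xk; apply: subg1; exact: sS.
Qed.

Lemma iota_morph g A : morph_on A (iota g).
Proof. by move=> x y _ _; rewrite !iotaE conjMg. Qed.

Lemma add_on_zpow n A (p : G -> 'rV[int]_n) x a : subgroup A ->
  (forall x y, A x -> A y -> p (x * y) = (p x + p y)%R) -> A x ->
  p (zpow x a) = (a *: p x)%R.
Proof.
move=> sA pD Ax; case: a => k; rewrite /zpow.
  by rewrite (add_onX sA pD)//= -natz scaler_nat.
rewrite (add_onV sA pD) ?(add_onX sA pD)//; last by grp.
by rewrite NegzE scaleNr -natz scaler_nat.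
Qed.

(** Horner's scheme carried out in the group: one and the same y realizes q(M) in the first section
    and q(M') in the second, which links an arbitrary section to the series S. *)
Lemma horner_mx_lift n m A A' (p : G -> 'rV[int]_n.+1) (p' : G -> 'rV[int]_m.+1) f M M'
    (q : {poly int}) x :
  subgroup A -> subgroup A' -> morph_on A f ->
  (forall x y, A x -> A y -> p (x * y) = (p x + p y)%R) ->
  (forall x y, A' x -> A' y -> p' (x * y) = (p' x + p' y)%R) ->
  (forall x, A x -> A (f x)) -> (forall x, A' x -> A' (f x)) ->
  induced_matrix A p f M -> induced_matrix A' p' f M' ->
  A x -> A' x ->
  exists y, [/\ A y, A' y, p y = p x *m horner_mx M q & p' y = p' x *m horner_mx M' q].
Proof.
move=> sA sA' fM pD pD' fA fA' pf pf' Ax A'x; elim/poly_ind: q => [|q a [y [Ay A'y py py']]].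
  exists 1; rewrite !rmorph0 !mulmx0 (add_on1 sA pD) (add_on1 sA' pD').
  by split=> //; exact: subg1.
have [Afy A'fy] := (fA y Ay, fA' y A'y).
have [Az A'z] := (zpow_sub a sA Ax, zpow_sub a sA' A'x).
exists (f y * zpow x a); split; [exact: subgM|exact: subgM| |].
  rewrite pD// pf// py (add_on_zpow _ sA pD)// !rmorphD !rmorphM/= !horner_mx_X !horner_mx_C.
  by rewrite mulmxDr mul_mx_scalar mulmxA.
rewrite pD'// pf'// py' (add_on_zpow _ sA' pD')// !rmorphD !rmorphM/= !horner_mx_X !horner_mx_C.
by rewrite mulmxDr mul_mx_scalar mulmxA.
Qed.

(** P applied to the action of g sends each class of A / B to a class that meets S (j+1); the same P
    serves all sections. *)
Let section_map g P j := forall A B n (p : G -> 'rV[int]_n.+1) M,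
  subgroup A -> A `<=` N -> (forall x, A x -> A (iota g x)) ->
  quotient_iso A B p -> induced_matrix A p (iota g) M ->
  forall x, A x -> exists y, [/\ A y, S j.+1 y & p y = p x *m horner_mx M P].

Let trivial_unity_rootsM P Q : trivial_unity_roots P -> trivial_unity_roots Q ->
  trivial_unity_roots (P * Q)%R.
Proof.
by move=> rP rQ z k k0 zk; rewrite rmorphM rootM => /orP[/(rP z k k0 zk)|/(rQ z k k0 zk)].
Qed.

(* Filter a section by the series S: [iota g - 1] maps it into S 1, and the       *)
(* characteristic polynomial of [iota g] on S i / S (i+1) maps S i into S (i+1).  *)
Let section_map_exists g j : N g -> (j <= c)%N ->
  exists P, trivial_unity_roots P /\ section_map g P j.
Proof.
move=> Ng; elim: j => [|j IH] jc.
  exists ('X - 1)%R; split=> [z k _ _|A B n p M sA AN gA pP pM x Ax].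
    by rewrite rmorphB/= map_polyX rmorph1 -polyC1 root_XsubC => /eqP.
  have [pD _ _] := pP; have Agx := gA x Ax.
  exists (iota g x * x^-1); split.
  - by apply: subgM => //; exact: subgV.
  - rewrite S1 iotaR mulgK; apply: derived_isolator_comm => //; apply: subgV => //; exact: AN.
  - rewrite pD ?(add_onV sA pD) ?pM//; last exact: subgV.
    by rewrite rmorphB/= horner_mx_X rmorph1 mulmxBr mulmx1.
have [P [rP mP]] := IH (ltnW jc).
have [S'S _ [m [p' pP']] noroot] := @SS j.+1 jc.
have sSj := sS (ltnW jc); have nSj := @nS j.+1 (ltnW jc).
have gS i x : (0 < i <= c.+1)%N -> S i x -> S i (iota g x).
  by move=> /nS[_ _ _ h] Sx; exact: h.
have [M' pM'] := induced_matrix_exists sSj pP' (@iota_morph g _) (fun x => gS j.+1 x (ltnW jc))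
  (fun x => gS j.+2 x jc).
case: m p' pP' M' pM' => [|m] p' pP' M' pM'.
  exists P; split=> // A B n p M sA AN gA pP pM x Ax.
  have [y [Ay Sy py]] := mP A B n p M sA AN gA pP pM x Ax; exists y; split=> //.
  by apply/(quotient_isoB pP') => //; apply/matrixP => ? [].
exists (P * char_poly M')%R; split.
  apply: trivial_unity_rootsM => // z k k0 zk; rewrite map_char_poly -eigenvalue_root_char.
  exact: noroot pP' pM' z k k0 zk.
move=> A B n p M sA AN gA pP pM x Ax.
have [y [Ay Sy py]] := mP A B n p M sA AN gA pP pM x Ax.
have [pD _ _] := pP; have [pD' _ _] := pP'.
have [z [Az Sz pz pz']] := horner_mx_lift (char_poly M') sA sSj (@iota_morph g _) pD pD' gA
  (fun x => gS j.+1 x (ltnW jc)) pM pM' Ay Sy.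
exists z; split=> //; last by rewrite pz py rmorphM/= mulmxA.
by apply/(quotient_isoB pP') => //; rewrite pz' Cayley_Hamilton mulmx0.
Qed.

(** The last term of S is trivial, so P(M) kills every class. Quantifying over all sections makes
    the eigenvalue condition available for subgroups of N. *)
Lemma NR_annihilated_data g : N g -> exists P, trivial_unity_roots P /\
  forall A B n (p : G -> 'rV[int]_n) M, subgroup A -> A `<=` N ->
  (forall x, A x -> A (iota g x)) -> quotient_iso A B p -> induced_matrix A p (iota g) M ->
  annihilates P M.
Proof.
move=> Ng; have [P [rP mP]] := section_map_exists Ng (leqnn c); exists P; split=> //.
move=> A B [|n] p M sA AN gA pP pM; first by apply/matrixP => -[].
apply/annihilatesP/row_matrixP => i; rewrite rowE.
have [x Ax <-] := quotient_iso_surj (delta_mx 0 i) pP.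
have [y [Ay]] := mP A B n p M sA AN gA pP pM x Ax.
rewrite Sc => -> <-; rewrite row0; have [pD _ _] := pP; exact: add_on1 pD.
Qed.

End NRGroup.

Section NRGroupFacts.
Variables (G : groupType) (N : set G).
Hypotheses (sN : subgroup N) (nrN : NR_group N).

Lemma NR_annihilated g : N g -> exists P, trivial_unity_roots P /\
  forall A B n (p : G -> 'rV[int]_n) M, subgroup A -> A `<=` N ->
  (forall x, A x -> A (iota g x)) -> quotient_iso A B p -> induced_matrix A p (iota g) M ->
  annihilates P M.
Proof. by have [_ [c [S [S1 Sc nS SS]]]] := nrN; exact: (NR_annihilated_data sN S1 Sc nS SS). Qed.

Lemma NR_sub_nilpotent D : subgroup D -> D `<=` N -> nilpotent (derived_isolator D).
Proof. by have [_ [c [S [S1 Sc nS SS]]]] := nrN; exact: (NR_nilpotent sN S1 Sc nS SS). Qed.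

Lemma NR_sub_torsion_free x k : (0 < k)%N -> derived_isolator N x -> (x ^+ k)%g = 1%g -> x = 1%g.
Proof. by have [_ [c [S [S1 Sc nS SS]]]] := nrN; exact: (NR_torsion_free S1 Sc nS SS). Qed.

End NRGroupFacts.

(** * Subgroups of finite index *)

Section Filtration.
Variables (G : groupType) (N D : set G).
Implicit Types (x y g : G) (f : G -> G).
Local Open Scope group_scope.
Hypotheses (sN : subgroup N) (nrN : NR_group N) (sD : subgroup D) (DN : D `<=` N).
Let H := derived_isolator D.
Let F := filtration D.
Let sH : subgroup H. Proof. exact: derived_isolator_subgroup. Qed.
Let nilH : nilpotent H. Proof. exact: (NR_sub_nilpotent sN nrN sD DN). Qed.
Let HD : H `<=` D. Proof. exact: derived_isolator_sub. Qed.

Lemma filtrationS i : filtration D i.+1 = isolator H (gam H i). Proof. by []. Qed.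

Lemma filtration1 : filtration D 1 = H.
Proof. by apply/seteqP; split=> [x []//|x Hx]; split=> //; exists 1%N. Qed.

Lemma filtration_subH i : filtration D i.+1 `<=` H. Proof. by move=> x []. Qed.

Lemma filtration_subgroup i : subgroup (filtration D i).
Proof.
case: i => [//|i]; rewrite filtrationS; apply: isolator_subgroup => //.
  exact: gam_subgroup.
exact: gam_sub.
Qed.

Lemma filtration_decr i : filtration D i.+1 `<=` filtration D i.
Proof.
case: i => [|i]; first by rewrite filtration1; exact: HD.
by move=> x [Hx [k k0 gx]]; split=> //; exists k => //; exact: gam_decr gx.
Qed.

Lemma filtration_sub i : filtration D i `<=` D.
Proof. by case: i => [//|i] x /filtration_subH /HD. Qed.

Lemma filtration_isolatedH i : isolated (filtration D i.+1) H.
Proof.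
move=> x k Hx k0 [_ [l l0 gx]]; split=> //; exists (k * l)%N; first by rewrite muln_gt0 k0.
by rewrite expgnA.
Qed.

Lemma filtration_isolated i : isolated (filtration D i.+1) (filtration D i).
Proof.
case: i => [|i]; first by rewrite filtration1; exact: derived_isolator_isolated.
by move=> x k /filtration_subH Hx; exact: filtration_isolatedH.
Qed.

Lemma filtration_normalH i : normal_subgroup (filtration D i.+1) H.
Proof.
split=> //; [exact: filtration_subgroup|exact: filtration_subH|].
move=> b a Hb [Ha [k k0 ga]]; split; first by grp.
exists k => //; rewrite iotaE -conjXg; apply: gam_conj => //; exact: subgV.
Qed.

(** A power of x lies in the lower central term, hence is central modulo the next isolator, and
    [central_root] extracts the root. *)
Lemma filtration_commH i x y : filtration D i.+1 x -> H y -> filtration D i.+2 [~ x, y].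
Proof.
move=> [Hx [k k0 gx]] Hy; have /(nilpotentP sH)[c gc] := nilH.
apply: (central_root sH gc (filtration_normalH i.+1) (@filtration_isolatedH i.+1) k0 Hx) => //.
move=> z Hz; apply: isolator_sub => //; [exact: gam_sub | exact: gamR].
Qed.

Lemma filtration_comm i x y : filtration D i x -> filtration D i y ->
  filtration D i.+1 [~ x, y].
Proof.
case: i => [|i] Fx Fy; first by rewrite filtration1; exact: derived_isolator_comm.
by apply: filtration_commH => //; exact: filtration_subH Fy.
Qed.

Lemma filtration_normal i : normal_subgroup (filtration D i.+1) (filtration D i).
Proof.
apply: normal_of_commutators; [exact: filtration_subgroup|exact: filtration_subgroup
  |exact: filtration_decr|].
by move=> x y /filtration_decr Fx Fy; exact: filtration_comm.
Qed.

Lemma filtration_quotient i :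
  exists n (p : G -> 'rV[int]_n), quotient_iso (filtration D i) (filtration D i.+1) p.
Proof.
apply: (free_abelian_quotient (NR_polycyclic nrN)).
- exact: filtration_subgroup.
- by move=> x /filtration_sub /DN.
- exact: filtration_normal.
- exact: filtration_comm.
- exact: filtration_isolated.
Qed.

Lemma derived_isolator_stable f : morph_on D f -> (forall x, D x -> D (f x)) ->
  forall x, H x -> H (f x).
Proof.
move=> fM fD x [Dx [k k0 gx]]; split; first exact: fD.
by exists k => //; rewrite -(morph_onX sD fM)//; exact: (@gam_image _ D 1 f).
Qed.

Lemma filtration_stable f i : morph_on D f -> (forall x, D x -> D (f x)) ->
  forall x, filtration D i x -> filtration D i (f x).
Proof.
move=> fM fD; case: i => [//|i] x [Hx [k k0 gx]].
have fH := derived_isolator_stable fM fD.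
split; first exact: fH.
exists k => //; rewrite -(morph_onX sD fM) ?HD//; first apply: gam_image => //; last exact: HD.
by move=> u v /HD Du /HD Dv; exact: fM.
Qed.

End Filtration.

Section FiniteIndex.
Variables (G : groupType) (D D' : set G).
Implicit Types (x y g : G).
Local Open Scope group_scope.
Hypotheses (nD' : normal_subgroup D' D) (fin : finite_index D' D).
Let sD' : subgroup D'. Proof. by case: nD'. Qed.
Let sD : subgroup D. Proof. by case: nD'. Qed.
Let D'D : D' `<=` D. Proof. by case: nD'. Qed.

Lemma finite_index_power x : D x -> exists2 k, (0 < k)%N & D' (x ^+ k).
Proof.
move=> Dx; pose L := fset_set (lcosets D' D).
pose s := mkseq (fun i => lcoset D' (x ^+ i)) (size L).+1.
have : ~~ uniq s.
  apply/negP => us; suff : (size s <= size L)%N by rewrite size_mkseq ltnn.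
  apply: uniq_leq_size us _ => Y /mapP[i _ ->].
  by rewrite in_fset_set// inE; exists (x ^+ i) => //; grp.
case/(uniqPn set0) => i [j [ij]]; rewrite size_mkseq => js.
rewrite !nth_mkseq//; last exact: ltn_trans js.
move/(lcoset_eq _ _ sD') => D'ij; exists (j - i)%N; first by rewrite subn_gt0.
by move: D'ij; rewrite -{1}(subnKC (ltnW ij)) expgnDr mulKg.
Qed.

Section Transfer.
Variables (n : nat) (p : G -> 'rV[int]_n).
Hypothesis pD : forall x y, D' x -> D' y -> p (x * y) = (p x + p y)%R.
Hypothesis pJ : forall x y, D' x -> D y -> p (x ^ y) = p x.

Let L := lcosets D' D.
Let r (Y : set G) := xget 1 Y.
Let act x (Y : set G) := [set x * y | y in Y].

Let LP Y : L Y -> D (r Y) /\ Y = lcoset D' (r Y).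
Proof.
move=> [x Dx <-]; have rY : lcoset D' x (r (lcoset D' x)).
  by apply: (@xgetPex _ 1 (lcoset D' x)); exists (x * 1), 1 => //; exact: subg1.
set rx := r _ in rY *; case: rY => a D'a e.
split; first by rewrite -e; apply: subgM => //; exact: D'D.
by apply/(lcoset_eq _ _ sD'); rewrite -e mulKg.
Qed.

Let act_coset x y : act x (lcoset D' y) = lcoset D' (x * y).
Proof.
apply/seteqP; split=> z.
  by move=> [_ [a D'a <-] <-]; exists a => //; rewrite mulgA.
by move=> [a D'a <-]; exists (y * a); [exists a | rewrite mulgA].
Qed.

Let actM x y Y : act (x * y) Y = act x (act y Y).
Proof.
apply/seteqP; split=> z; first by move=> [w Yw <-]; exists (y * w); [exists w|rewrite mulgA].
by move=> [_ [w Yw <-] <-]; exists w => //; rewrite mulgA.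
Qed.

Let act1 Y : act 1 Y = Y.
Proof.
apply/seteqP; split=> z; first by move=> [w Yw <-]; rewrite mul1g.
by move=> Yz; exists z => //; rewrite mul1g.
Qed.

Let actL x Y : D x -> L Y -> L (act x Y).
Proof. by move=> Dx [y Dy <-]; rewrite act_coset; exists (x * y) => //; exact: subgM. Qed.

Let act_bij x : D x -> set_bij L L (act x).
Proof.
move=> Dx; split=> [Y LY|Y Z _ _ e|Y LY]; first exact: actL.
  by rewrite -[Y]act1 -[Z]act1 -(mulVg x) !actM e.
exists (act x^-1 Y); first by apply: actL => //; exact: subgV.
by rewrite -actM mulgV act1.
Qed.

(** The transfer from D to D', composed with p. *)
Let V x : 'rV[int]_n := (\sum_(Y \in L) p ((r (act x Y))^-1 * (x * r Y)))%R.

Let D'r x Y : D x -> L Y -> D' ((r (act x Y))^-1 * (x * r Y)).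
Proof.
move=> Dx LY; have [DrY YE] := LP LY; have [_ YxE] := LP (actL Dx LY).
apply/(lcoset_eq _ _ sD'); rewrite -YxE {1}YE act_coset //.
Qed.

Let VD x y : D x -> D y -> V (x * y) = (V x + V y)%R.
Proof.
move=> Dx Dy; rewrite /V [X in (X + _)%R](reindex_fsbig _ _ _ _ (act_bij Dy)).
rewrite -fsbig_split//; apply: eq_fsbigr => Y; rewrite inE => LY /=.
rewrite -pD; [|exact: D'r (actL Dy LY)|exact: D'r].
by rewrite actM; congr p; rewrite -!mulgA mulVKg.
Qed.

(** Elements of the normal subgroup D' fix every coset, and each summand is p of a D-conjugate of
    x. *)
Let V_sub x : D' x -> V x = (p x *+ size (fset_set L))%R.
Proof.
move=> D'x; have Dx := D'D D'x.
rewrite /V fsbig_finite// (eq_big_seq (fun=> p x)) => [|Y].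
  by rewrite big_const_seq count_predT iter_addr_0.
rewrite in_fset_set// inE => LY; have [DrY YE] := LP LY.
have D'xr : D' (x ^ r Y) by exact: normalJ nD' D'x DrY.
have -> : act x Y = Y.
  rewrite {1}YE act_coset [RHS]YE; apply/(lcoset_eq _ _ sD').
  by rewrite invgM -mulgA -conjgE conjVg; exact: subgV.
by rewrite -conjgE pJ.
Qed.

Let V_comm x : commutator D D x -> V x = 0%R.
Proof.
have kerD : subgroup [set x | D x /\ V x = 0%R].
  split; first by split; [exact: subg1 | exact: (add_on1 sD VD)].
  move=> y z [Dy Vy] [Dz Vz]; have DzV := subgV sD Dz; split; first exact: subgM.
  by rewrite VD// (add_onV sD VD)// Vy Vz subr0.
have : commutator D D `<=` [set x | D x /\ V x = 0%R].
  apply: commutator_min => // y z Dy Dz; split; first exact: subgR.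
  exact: (add_onR sD VD).
by move=> h /h[].
Qed.

(** The transfer maps to an abelian group, so it kills [D, D]; on D' it is p times the nonzero
    index, and Z^n has no torsion. *)
Lemma transfer_commutator x : D' x -> commutator D D x -> p x = 0%R.
Proof.
move=> D'x /V_comm; rewrite V_sub// => /rowP px; apply/rowP => i.
have := px i; rewrite mulmxnE !mxE => /eqP; rewrite mulrn_eq0 => /orP[|/eqP//].
rewrite size_eq0 => /eqP L0; have : L (lcoset D' 1) by exists 1 => //; exact: subg1.
move=> L1; suff : lcoset D' 1 \in [::] by [].
by rewrite -L0 in_fset_set ?inE.
Qed.

End Transfer.

Hypothesis Dcent : forall n (p : G -> 'rV[int]_n), quotient_iso D' (derived_isolator D') p ->
  forall x y, D' x -> D y -> p (x ^ y) = p x.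
Hypothesis Dfree : exists n (p : G -> 'rV[int]_n), quotient_iso D' (derived_isolator D') p.

Lemma derived_isolator_finite_index :
  derived_isolator D' = derived_isolator D `&` D'.
Proof.
apply/seteqP; split=> x; first by move=> Hx; split; [exact: derived_isolatorS Hx|have [] := Hx].
move=> [[Dx [k k0 Cx]] D'x]; have [n [p pP]] := Dfree; have [pD _ _] := pP.
apply: (@derived_isolator_isolated _ D' x k D'x k0); apply/(quotient_isoB pP); first exact: subgX.
by apply: (transfer_commutator pD (Dcent pP)) => //; exact: subgX.
Qed.

End FiniteIndex.

Section FiniteIndexNR.
Variables (G : groupType) (N D D' : set G).
Implicit Types (x y g : G) (f : G -> G).
Local Open Scope group_scope.
Hypotheses (sN : subgroup N) (nrN : NR_group N) (DN : D `<=` N).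
Hypotheses (nD' : normal_subgroup D' D) (fin : finite_index D' D).
Let sD' : subgroup D'. Proof. by case: nD'. Qed.
Let sD : subgroup D. Proof. by case: nD'. Qed.
Let D'D : D' `<=` D. Proof. by case: nD'. Qed.
Let D'N : D' `<=` N. Proof. exact: subset_trans D'D DN. Qed.

Lemma induced_iotaX A n (p : G -> 'rV[int]_n) g M k :
  (forall x, A x -> A (iota g x)) ->
  induced_matrix A p (iota g) M -> induced_matrix A p (iota (g ^+ k)) (M ^+ k)%R.
Proof.
move=> gA pM; elim: k => [|k IH] x Ax; first by rewrite expg0 iota1 expr0 mulmx1.
by rewrite expgSr iota_mul (IH _ (gA x Ax)) (pM x Ax) exprS mulmxA.
Qed.

(* [D] acts on the free abelian group [D' / derived_isolator D'] through a finite *)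
(* group, and the only root of unity among the eigenvalues is 1.                  *)
Lemma finite_index_central n (p : G -> 'rV[int]_n) : quotient_iso D' (derived_isolator D') p ->
  forall x y, D' x -> D y -> p (x ^ y) = p x.
Proof.
move=> pP x y D'x Dy; have Dyi := subgV sD Dy; rewrite -[y]invgK -iotaE.
set g := y^-1 in Dyi *; have gD' z : D' z -> D' (iota g z) by move=> D'z; have [_ _ _] := nD'; exact.
have gM := @iota_morph _ g.
have [M pM] := induced_matrix_exists sD' pP (gM _) gD'
  (derived_isolator_stable sD' (gM _) gD').
have [P [rP aP]] := NR_annihilated sN nrN (DN Dyi).
have [m m0 D'gm] := finite_index_power nD' fin Dyi.
have [pD _ _] := pP.
have Mm : (M ^+ m = 1)%R.
  apply: (induced_matrix_uniq pP (induced_iotaX m gD' pM)) => z D'z.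
  by rewrite mulmx1 iotaE (add_onJ sD' pD)//; exact: subgV.
by rewrite pM// (finite_order_eq1 rP (aP _ _ _ _ _ sD' D'N gD' pP pM) m0 Mm) mulmx1.
Qed.

Lemma derived_isolator_sub_finite_index :
  derived_isolator D' = derived_isolator D `&` D'.
Proof.
apply: derived_isolator_finite_index => //; first exact: finite_index_central.
by have := filtration_quotient sN nrN sD' D'N 0; rewrite filtration1.
Qed.

Let H := derived_isolator D.
Let H' := derived_isolator D'.

Let H'H : H' `<=` H. Proof. exact: derived_isolatorS. Qed.

Lemma gam_finite_index i x : gam H i x -> exists2 m, (0 < m)%N & gam H' i (x ^+ m).
Proof.
have sH : subgroup H by exact: derived_isolator_subgroup.
have sH' : subgroup H' by exact: derived_isolator_subgroup.
have /(nilpotentP sH)[c gc] := NR_sub_nilpotent sN nrN sD DN.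
apply: (gam_power sH sH' H'H (S := H)) gc => //; first exact: sub_generated.
move=> h Hh; have [k k0 D'h] := finite_index_power nD' fin (derived_isolator_sub Hh).
by exists k => //; rewrite /H' derived_isolator_sub_finite_index; split=> //; exact: subgX.
Qed.

Lemma filtration_finite_index i : filtration D' i = filtration D i `&` D'.
Proof.
case: i => [|i]; first by rewrite /= setIidr.
rewrite !filtrationS; apply/seteqP; split=> x.
  move=> [Hx [k k0 gx]]; split; last exact: derived_isolator_sub Hx.
  split; first exact: H'H.
  by exists k => //; apply: gam_mono gx => //; exact: derived_isolator_subgroup.
move=> [[Hx [k k0 gx]] D'x].
split; first by rewrite derived_isolator_sub_finite_index.
have [m m0 gxm] := gam_finite_index gx; exists (k * m)%N; first by rewrite muln_gt0 k0.
by rewrite expgnA.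
Qed.

(** If a lower central term of H' is trivial, the one of H is torsion inside a torsion-free group.
    So both [tau] products have the same number of factors. *)
Lemma nilpotency_class_finite_index : nilpotency_class H' = nilpotency_class H.
Proof.
have sH : subgroup H by exact: derived_isolator_subgroup.
have sH' : subgroup H' by exact: derived_isolator_subgroup.
suff e c : lower_central H' c.+1 = [set 1] <-> lower_central H c.+1 = [set 1].
  rewrite /nilpotency_class; congr xget; apply/seteqP; split=> c [/e ec cmin];
    by split=> // d /e; exact: cmin.
split=> gc; apply/seteqP; split=> x.
- move=> gx; have [m m0] := gam_finite_index gx; rewrite gc => xm.
  apply: (NR_sub_torsion_free nrN m0) => //.
  by apply: (derived_isolatorS sN DN); exact: gam_sub gx.
- by move->; apply: subg1; exact: gam_subgroup.
- by rewrite -gc; apply: gam_mono.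
- by move->; apply: subg1; exact: gam_subgroup.
Qed.

Lemma tau_finite_index f : morph_on D f -> (forall x, D x -> D (f x)) ->
  (forall x, D' x -> D' (f x)) -> tau D' f = tau D f.
Proof.
move=> fM fD fD'; rewrite /tau nilpotency_class_finite_index.
have fM' : morph_on D' f by move=> x y /D'D Dx /D'D Dy; exact: fM.
apply: eq_bigr => i _; congr (absz _).
have [n [p pP]] := filtration_quotient sN nrN sD DN i.
have [n' [p' pP']] := filtration_quotient sN nrN sD' D'N i.
have sF j := filtration_subgroup sN nrN sD DN j.
have sF' j := filtration_subgroup sN nrN sD' D'N j.
have fF j : forall x, filtration D j x -> filtration D j (f x) by exact: filtration_stable.
have fF' j : forall x, filtration D' j x -> filtration D' j (f x) by exact: filtration_stable.
have FD j : filtration D j `<=` D by exact: filtration_sub.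
have FD' j : filtration D' j `<=` D' by exact: filtration_sub.
have fMF : morph_on (filtration D i) f by move=> x y /FD Dx /FD Dy; exact: fM.
have fMF' : morph_on (filtration D' i) f by move=> x y /FD' Dx /FD' Dy; exact: fM'.
have [M pM] := induced_matrix_exists (sF i) pP fMF (fF i) (fF i.+1).
have [M' pM'] := induced_matrix_exists (sF' i) pP' fMF' (fF' i) (fF' i.+1).
rewrite (quotient_detE (sF i) pP (fF i) pM) (quotient_detE (sF' i) pP' (fF' i) pM').
apply/esym/(det_sub1_commensurable (sF i) (sF' i) _ _ pP _ (fF' i) pM pM').
- by rewrite filtration_finite_index => x [].
- move=> x Fx; have [k k0 D'x] := finite_index_power nD' fin (FD _ _ Fx).
  by exists k => //; rewrite filtration_finite_index; split=> //; exact: subgX.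
- suff -> : filtration D i.+1 `&` filtration D' i = filtration D' i.+1 by [].
  rewrite !filtration_finite_index setIA; congr (_ `&` _).
  by apply/setIidl; exact: filtration_decr.
Qed.

End FiniteIndexNR.

(** * Twisting by an inner automorphism *)

Section InnerTwist.
Variables (G : groupType) (N D : set G).
Implicit Types (x y g h : G).
Local Open Scope group_scope.
Hypotheses (sN : subgroup N) (nrN : NR_group N) (sD : subgroup D) (DN : D `<=` N).
Let H := derived_isolator D.
Let sH : subgroup H. Proof. exact: derived_isolator_subgroup. Qed.

Variable psi : G -> G.
Hypotheses (psiM : morph_on D psi) (psiD : forall x, D x -> D (psi x)).

Variable d : G.
Hypothesis Dd : D d.

(* d psi(d) ... psi^(k-1)(d) *)
Let norm_elt k := iter k (fun h => d * psi h) 1.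

Let D_norm k : D (norm_elt k).
Proof. by elim: k => [|k IH] /=; [exact: subg1 | apply: subgM => //; exact: psiD]. Qed.

Let D_iter k x : D x -> D (iter k psi x).
Proof. by elim: k => [//|k IH] Dx /=; apply: psiD; exact: IH. Qed.

Section TopQuotient.
Variables (n : nat) (p : G -> 'rV[int]_n) (M : 'M[int]_n).
Hypotheses (pP : quotient_iso D H p) (pM : induced_matrix D p psi M).
Local Open Scope ring_scope.

Let pD : forall x y, D x -> D y -> p (x * y)%g = p x + p y. Proof. by case: pP. Qed.

(** The geometric sum 1 + M + ... + M^(k-1). *)
Let geo k : 'M[int]_n := iter k (fun S => 1%:M + S *m M) 0.

Let geoE k : (1%:M - M) *m geo k = 1%:M - M ^+ k.
Proof.
elim: k => [|k IH]; first by rewrite mulmx0 expr0 subrr.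
rewrite /geo iterS -/(geo k) mulmxDr mulmx1 mulmxA IH mulmxBl mul1mx addrA subrK.
by rewrite exprSr.
Qed.

Let p_norm k : p (norm_elt k) = p d *m geo k.
Proof.
elim: k => [|k IH]; first by rewrite mulmx0 (add_on1 sD pD).
rewrite /= pD ?pM//; [|exact: psiD].
by rewrite IH mulmxDr mulmx1 mulmxA.
Qed.

Let p_iter k x : D x -> p (iter k psi x) = p x *m M ^+ k.
Proof.
move=> Dx; elim: k => [|k IH]; first by rewrite expr0 mulmx1.
by rewrite /= pM ?IH ?exprSr ?mulmxA//; exact: D_iter.
Qed.

(** An x with p(x) (1 - M) = m p(d) works for all k at once, since multiplying by the geometric sum
    gives p(x) (1 - M^k) = m p([norm_elt k]). *)
Lemma norm_power : \det (1%:M - M) != 0 -> exists m x, [/\ (0 < m)%N, D x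
  & forall k, H ((x * (iter k psi x)^-1)^-1 * norm_elt k ^+ m)%g].
Proof.
set e := \det _ => e0.
(* The adjugate contributes one factor e; the second makes m = e^2 positive. *)
have [x Dx px] := quotient_iso_surj (e *: (p d *m \adj (1%:M - M))) pP.
exists (absz (e * e)), x; split=> //; first by rewrite absz_gt0 mulf_neq0.
move=> k; have Dkx := D_iter k Dx; apply/(quotient_isoB pP); first by grp.
rewrite pD ?(add_onV sD pD) ?(add_onX sD pD) ?pD ?(add_onV sD pD)//; try by grp.
rewrite p_iter// p_norm -{1}[p x]mulmx1 -mulmxBr -geoE px mulmxA -scalemxAl -(mulmxA (p d)).
rewrite mul_adj_mx mul_mx_scalar scalerA -/e -scalemxAl.
by rewrite -scaler_nat natz gez0_abs ?sqr_ge0// addNr.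
Qed.

End TopQuotient.

Section LowerQuotient.
Variables (i n : nat) (p : G -> 'rV[int]_n) (M : 'M[int]_n).
Let F := filtration D i.+1.
Hypotheses (pP : quotient_iso F (filtration D i.+2) p) (pM : induced_matrix F p psi M).

Let FD x : F x -> D x. Proof. exact: filtration_sub. Qed.
Let sF : subgroup F. Proof. exact: (filtration_subgroup sN nrN sD DN). Qed.
Let pD x y : F x -> F y -> p (x * y) = (p x + p y)%R. Proof. by case: pP => h _ _; exact: h. Qed.
Let F_stable f : morph_on D f -> (forall x, D x -> D (f x)) -> forall j x,
  filtration D j x -> filtration D j (f x).
Proof. by move=> fM fD j; exact: filtration_stable. Qed.
Let F_iota h : D h -> forall j x, filtration D j x -> filtration D j (iota h x).
Proof. by move=> Dh; apply: F_stable; [exact: iota_morph | move=> x Dx; exact: subg_iota]. Qed.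
Let F_psi : forall j x, filtration D j x -> filtration D j (psi x).
Proof. exact: F_stable. Qed.

Let matrix_of h : exists A : 'M[int]_n, D h -> induced_matrix F p (iota h) A.
Proof.
have [Dh|nDh] := pselect (D h); last by exists 0%R.
have [A pA] := induced_matrix_exists sF pP (@iota_morph _ h _) (F_iota Dh (j := i.+1)) (F_iota Dh (j := i.+2)).
by exists A.
Qed.

(** Specified for h in D only. With row vectors, [alpha] reverses products. *)
Let alpha h : 'M[int]_n := projT1 (cid (matrix_of h)).
Let alphaP h : D h -> induced_matrix F p (iota h) (alpha h).
Proof. exact: (projT2 (cid (matrix_of h))). Qed.

Local Open Scope ring_scope.

Let alphaM g h : D g -> D h -> alpha (g * h)%g = alpha h *m alpha g.
Proof.
move=> Dg Dh; apply: (induced_matrix_uniq pP (alphaP (subgM sD Dg Dh))) => x Fx.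
rewrite iota_mul (alphaP Dg); last exact: F_iota.
by rewrite (alphaP Dh)// mulmxA.
Qed.

(** The filtration is a central series of H. Hence [alpha] factors through the abelian group D / H,
    and its values commute. *)
Let alpha_H h : H h -> alpha h = 1%:M.
Proof.
move=> Hh; have Dh := derived_isolator_sub Hh.
apply: (induced_matrix_uniq pP (alphaP Dh)) => x Fx; rewrite mulmx1.
have F'c : filtration D i.+2 [~ h^-1, x^-1]%g.
  rewrite -invgR; apply: subgV; first exact: (filtration_subgroup sN nrN sD DN).
  by apply: (filtration_commH sN nrN sD DN); [exact: (subgV sF Fx)|exact: (subgV sH Hh)].
have Fc : F [~ h^-1, x^-1]%g by exact: (filtration_decr sD).
by rewrite iotaR pD// (quotient_isoB pP Fc).2// add0r.
Qed.

Let alpha1 : alpha 1%g = 1%:M. Proof. by apply: alpha_H; exact: subg1. Qed.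

Let alpha_mod g h : D g -> D h -> H (g^-1 * h)%g -> alpha g = alpha h.
Proof.
move=> Dg Dh Hgh; rewrite -[in RHS](mulVKg g h) alphaM//; last by grp.
by rewrite (alpha_H Hgh) mul1mx.
Qed.

Let alphaC g h : D g -> D h -> alpha g *m alpha h = alpha h *m alpha g.
Proof.
move=> Dg Dh; rewrite -!alphaM//; apply: alpha_mod; try by grp.
rewrite invgM -!mulgA -conjgE -commgEl; exact: derived_isolator_comm.
Qed.

Let alphaX h k : D h -> alpha (h ^+ k)%g = alpha h ^+ k.
Proof.
move=> Dh; elim: k => [|k IH]; first by rewrite expg0 alpha1 expr0.
by rewrite expgSr alphaM ?IH ?exprS//; exact: subgX.
Qed.

Let alpha_psi h : D h -> alpha h *m M = M *m alpha (psi h).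
Proof.
move=> Dh; apply/row_matrixP => j; rewrite !rowE !mulmxA.
have [x Fx <-] := quotient_iso_surj (delta_mx 0 j) pP; have Dx := FD Fx.
have Fpx : F (psi x) by exact: F_psi.
rewrite -(alphaP Dh)// -pM; last exact: F_iota.
rewrite -pM// -(alphaP (psiD Dh))//; congr p.
by rewrite /iota !psiM ?(morph_onV sD psiM)//; grp.
Qed.

Let alpha_iter h k : D h -> alpha h *m M ^+ k = M ^+ k *m alpha (iter k psi h).
Proof.
move=> Dh; elim: k => [|k IH]; first by rewrite expr0 mulmx1 mul1mx.
rewrite exprSr mulmxA IH -!mulmxA alpha_psi//; exact: D_iter.
Qed.

Let twist_power k : (M *m alpha d) ^+ k = M ^+ k *m alpha (norm_elt k).
Proof.
elim: k => [|k IH]; first by rewrite !expr0 alpha1 mulmx1.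
rewrite exprSr IH /= alphaM//; last exact: psiD.
by rewrite exprSr -!mulmxE -!mulmxA; congr (_ *m _); rewrite !mulmxA alpha_psi.
Qed.

(** Moving the matrix of psi^k(x)^-1 across M^k turns it into that of x^-1, which cancels the matrix
    of x under the trace. *)
Let trace_coboundary k x h : D x -> D h ->
  \tr (alpha (x * (iter k psi x)^-1 * h)%g *m M ^+ k) = \tr (alpha h *m M ^+ k).
Proof.
move=> Dx Dh; have Dkx := D_iter k Dx; have DkV := subgV sD Dkx; have DxV := subgV sD Dx.
rewrite !alphaM//; last exact: subgM.
rewrite mulmxA [alpha h *m _]alphaC// -!mulmxA mxtrace_mulC -!mulmxA.
have -> : alpha (iter k psi x)^-1%g = alpha (iter k psi x^-1%g).
  congr alpha; elim: k {Dkx DkV} => [//|k IH] /=.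
  by rewrite -IH (morph_onV sD psiM)//; exact: D_iter.
rewrite -alpha_iter// !mulmxA -[alpha h *m _ *m _]mulmxA -alphaM// mulVg.
by rewrite alpha1 mulmx1.
Qed.

(** For h = [norm_elt k], the power h^m is a coboundary modulo H, so tr(alpha(h)^j M^k) has period m
    in j. By [periodic_trace] the values at j = 1 and j = 0 agree; these are the traces of the k-th
    powers of the twisted and the untwisted matrix. *)
Lemma twist_det m x : (0 < m)%N -> D x ->
  (forall k, H ((x * (iter k psi x)^-1)^-1 * norm_elt k ^+ m)%g) ->
  exists A, induced_matrix F p (iota d \o psi) A /\ \det (1%:M - A) = \det (1%:M - M).
Proof.
move=> m0 Dx Hx; exists (M *m alpha d); split.
  by move=> y Fy /=; rewrite alphaP// ?pM ?mulmxA//; exact: F_psi.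
apply: det_sub1_of_int_traces => k _; rewrite twist_power mxtrace_mulC.
have Dh := D_norm k; set h := norm_elt k in Dh *; have Dkx := D_iter k Dx.
have [P [rP aP]] := NR_annihilated sN nrN (DN Dh).
have FN : F `<=` N by move=> y /FD /DN.
apply: (periodic_trace rP (aP _ _ _ _ _ sF FN (F_iota Dh (j := i.+1)) pP (alphaP Dh)) m0) => j.
rewrite -!alphaX// -[RHS](trace_coboundary k Dx (subgX j sD Dh)).
congr (\tr (_ *m _)); apply/esym/alpha_mod; try by grp.
rewrite addnC expgnDr.
have -> : ((x / iter k psi x * h ^+ j)^-1 * (h ^+ m * h ^+ j) =
  ((x / iter k psi x)^-1 * h ^+ m) ^ (h ^+ j))%g by rewrite conjgE invgM !mulgA.
exact: (normalJ (derived_isolator_normal sD) (Hx k) (subgX j sD Dh)).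
Qed.

End LowerQuotient.

Lemma tau_iota : tau D (iota d \o psi) = tau D psi.
Proof.
have twM A : A `<=` D -> morph_on A (iota d \o psi).
  by move=> AD x y /AD Dx /AD Dy /=; rewrite psiM// !iotaE conjMg.
have psiMA A : A `<=` D -> morph_on A psi by move=> AD x y /AD Dx /AD Dy; exact: psiM.
have twD x : D x -> D ((iota d \o psi) x) by move=> Dx /=; apply: subg_iota => //; exact: psiD.
have FD i : filtration D i `<=` D by exact: filtration_sub.
have sF j := filtration_subgroup sN nrN sD DN j.
have Fpsi j : forall x, filtration D j x -> filtration D j (psi x) by exact: filtration_stable.
have Ftw j : forall x, filtration D j x -> filtration D j ((iota d \o psi) x).
  by apply: filtration_stable => //; exact: twM.
have [n0 [p0 pP0]] := filtration_quotient sN nrN sD DN 0.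
have [M0 pM0] := induced_matrix_exists (sF 0%N) pP0 (psiMA _ (FD 0%N)) (Fpsi 0%N) (Fpsi 1%N).
have [pD0 _ _] := pP0.
have pM0' : induced_matrix (filtration D 0) p0 (iota d \o psi) M0.
  by move=> x Dx /=; rewrite iotaE (add_onJ sD pD0) ?pM0//; [exact: psiD|exact: subgV].
have e0 := quotient_detE (sF 0%N) pP0 (Fpsi 0%N) pM0.
have e0' := quotient_detE (sF 0%N) pP0 (Ftw 0%N) pM0'.
(* Conjugation is trivial on the top factor, so both products begin with the same determinant. If it
   is 0 both vanish; otherwise one pair m, x serves all lower factors. *)
rewrite /tau !big_nat_recl// e0 e0'; have [->|dM0] := eqVneq (\det (1%:M - M0)) 0%R.
  by rewrite absz0 !mul0n.
rewrite filtration1 in pP0.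
have [m [x [m0 Dx Hx]]] := norm_power pP0 pM0 dM0.
congr (_ * _)%N; apply: eq_bigr => i _; congr absz.
have [n [p pP]] := filtration_quotient sN nrN sD DN i.+1.
have [M pM] := induced_matrix_exists (sF i.+1) pP (psiMA _ (FD i.+1)) (Fpsi i.+1) (Fpsi i.+2).
have [A [pA eA]] := twist_det pP pM m0 Dx Hx.
by rewrite (quotient_detE (sF i.+1) pP (Fpsi i.+1) pM) (quotient_detE (sF i.+1) pP (Ftw i.+1) pA) eA.
Qed.

End InnerTwist.

(** * Averaging over cosets *)

Section Cosets.
Variable G : groupType.
Implicit Types (A B C D : set G) (x y : G).
Local Open Scope group_scope.

Lemma lcoset_repr A C Y : subgroup A -> subgroup C -> A `<=` C -> lcosets A C Y ->
  C (xget 1 Y) /\ Y = lcoset A (xget 1 Y).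
Proof.
move=> sA sC AC [x Cx <-]; have rY : lcoset A x (xget 1 (lcoset A x)).
  by apply: (@xgetPex _ 1 (lcoset A x)); exists (x * 1), 1 => //; exact: subg1.
set rx := xget _ _ in rY *; case: rY => a Aa e.
split; first by rewrite -e; apply: subgM => //; exact: AC.
by apply/(lcoset_eq _ _ sA); rewrite -e mulKg.
Qed.

Lemma finite_indexI A C : subgroup A -> subgroup C -> finite_index A setT ->
  finite_index (A `&` C) C.
Proof.
move=> sA sC fA; apply: sub_finite_set (finite_image (fun X => X `&` C) fA).
move=> _ [x Cx <-]; exists (lcoset A x); first by exists x.
apply/seteqP; split=> [_ [[a Aa <-] Cxa]|_ [a [Aa Ca] <-]]; last first.
  by split; [exists a | exact: subgM].
by exists a => //; split=> //; rewrite -[a](mulKg x); apply: subgM => //; exact: subgV.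
Qed.

Lemma finite_index_setI A B : finite_index A setT -> finite_index B setT ->
  finite_index (A `&` B) setT.
Proof.
move=> fA fB; apply: sub_finite_set (finite_image (fun X => X.1 `&` X.2) (finite_setX fA fB)).
move=> _ [x _ <-]; exists (lcoset A x, lcoset B x); first by split; exists x.
apply/seteqP; split=> [_ [[a Aa <-] [b Bb /mulgI ba]]|_ [a [Aa Ba] <-]] /=.
  by exists a => //; split=> //; rewrite -ba.
by split; exists a.
Qed.

(** Each coset of B in C splits into [B : A] cosets of A, on which f takes the same value. The
    bijection multiplies chosen representatives. *)
Lemma average_cosets A B C (f : G -> rat) : subgroup A -> subgroup B -> subgroup C ->
  A `<=` B -> B `<=` C -> finite_index A C -> finite_index B C ->
  (forall x y, C x -> B y -> f (x * y) = f x) ->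
  ((subgroup_index A C)%:R^-1 * \sum_(Y \in lcosets A C) f (xget 1%g Y) =
   (subgroup_index B C)%:R^-1 * \sum_(Y \in lcosets B C) f (xget 1%g Y))%R.
Proof.
move=> sA sB sC AB BC fAC fBC fB; have AC := subset_trans AB BC.
have fAB : finite_index A B.
  by apply: sub_finite_set fAC => _ [x Bx <-]; exists x => //; exact: BC.
pose h (p : set G * set G) := lcoset A (xget 1%g p.1 * xget 1%g p.2).
have repB Y := @lcoset_repr B C Y sB sC BC.
have repA Y := @lcoset_repr A B Y sA sB AB.
have repAC Y := @lcoset_repr A C Y sA sC AC.
have hbij : set_bij (lcosets B C `*` lcosets A B) (lcosets A C) h.
  split=> [[Y W] [/= LY LW]|[Y W] [Y' W']|Z LZ].
  - have [CY _] := repB _ LY; have [BW _] := repA _ LW.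
    by exists (xget 1%g Y * xget 1%g W) => //; apply: subgM => //; exact: BC.
  - rewrite !inE => -[/= LY LW] [/= LY' LW'] /(lcoset_eq _ _ sA)/=.
    have [CY YE] := repB _ LY; have [BW WE] := repA _ LW.
    have [CY' YE'] := repB _ LY'; have [BW' WE'] := repA _ LW'.
    set y := xget 1%g Y in CY YE *; set y' := xget 1%g Y' in CY' YE' *.
    set w := xget 1%g W in BW WE *; set w' := xget 1%g W' in BW' WE' *.
    move=> Ah; have YY' : Y = Y'.
      rewrite YE YE'; apply/(lcoset_eq _ _ sB).
      have -> : y^-1 * y' = w * ((y * w)^-1 * (y' * w')) * w'^-1.
        by rewrite invgM !mulgA mulgV mul1g mulgK.
      by apply: subgM => //; [apply: subgM => //; exact: AB | exact: subgV].
    congr pair => //; rewrite WE WE'; apply/(lcoset_eq _ _ sA).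
    by move: Ah; rewrite /y /y' YY' invgM -mulgA mulKg.
  - have [CZ ZE] := repAC _ LZ; set z := xget 1%g Z in CZ ZE *.
    have LY : lcosets B C (lcoset B z) by exists z.
    have [CY /(lcoset_eq _ _ sB) Bzy] := repB _ LY; set y := xget 1%g _ in CY Bzy.
    have Byz : B (y^-1 * z) by rewrite -[z]invgK -invgM; exact: subgV.
    have LW : lcosets A B (lcoset A (y^-1 * z)) by exists (y^-1 * z).
    have [BW /(lcoset_eq _ _ sA) Aw] := repA _ LW; set w := xget 1%g _ in BW Aw.
    exists (lcoset B z, lcoset A (y^-1 * z)) => //.
    rewrite /h /= -/y -/w ZE; apply/(lcoset_eq _ _ sA).
    by have := subgV sA Aw; rewrite invgM invgK mulgA -invgM.
(* Kept general in g, because g = 1 yields the multiplicativity of the index. *)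
have sumE (g : G -> rat) : (forall x y, C x -> B y -> g (x * y) = g x) ->
    (\sum_(Y \in lcosets A C) g (xget 1%g Y) =
     (subgroup_index A B)%:R * \sum_(Y \in lcosets B C) g (xget 1%g Y))%R.
  move=> gB; rewrite (reindex_fsbig _ _ _ _ hbij).
  rewrite -(pair_fsbig _ (fun Y W => g (xget 1%g (h (Y, W)))))//.
  rewrite mulr_fsumr; apply: eq_fsbigr => Y; rewrite inE => LY.
  have [CY _] := repB _ LY.
  rewrite fsbig_finite// (eq_big_seq (fun=> g (xget 1%g Y))) => [|W].
    by rewrite big_const_seq count_predT iter_addr_0 mulr_natl.
  rewrite in_fset_set// inE => LW; have [BW _] := repA _ LW.
  have LZ : lcosets A C (h (Y, W)).
    by exists (xget 1%g Y * xget 1%g W) => //; apply: subgM => //; exact: BC.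
  have [CZ /(lcoset_eq _ _ sA)/AB Bz] := repAC _ LZ.
  rewrite -[xget 1%g (h _)](mulVKg (xget 1%g Y * xget 1%g W)) -mulgA gB//.
  exact: subgM.
have one_sum A' : finite_index A' C ->
    (\sum_(Y \in lcosets A' C) (1 : rat) = (subgroup_index A' C)%:R)%R.
  move=> fA'; rewrite (fsbig_finite _ _ fA').
  by rewrite big_const_seq count_predT iter_addr_0.
have indexE : ((subgroup_index A C)%:R = (subgroup_index A B)%:R * (subgroup_index B C)%:R :> rat)%R.
  by rewrite -!one_sum// (sumE (fun=> 1%R)).
have k0 : ((subgroup_index A B)%:R != 0 :> rat)%R.
  rewrite pnatr_eq0 size_eq0; apply/eqP => L0.
  have L1 : lcosets A B (lcoset A 1) by exists 1 => //; exact: subg1.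
  suff : lcoset A 1 \in [::] by [].
  by rewrite -L0 in_fset_set ?inE.
by rewrite indexE sumE// invfM -mulrA [(_^-1 * (_ * _))%R]mulrCA mulKf.
Qed.

End Cosets.

(** * Comparison of the sums for nested normal subgroups *)

Section Rtilde.
Variables (G : groupType) (phi : {multiplicative G -> G}).
Implicit Types (N K : set G) (X : set G) (t g : G).
Local Open Scope group_scope.

(** The choices in [Rtilde_term] do not fall back on their default: the class is nonempty and, being
    fixed, contains phi(t). *)
Lemma fixed_class_repr X t : fixed_torsion_classes phi X -> t = xget 1 X ->
  t = iota (xget 1 [set g | t = iota g (phi t)]) (phi t).
Proof.
move=> [[s _ Xs] /= fixX] tE; apply: (@xgetPex _ 1 [set g | t = iota g (phi t)]).
have Xt : X t.
  by rewrite tE; apply: (@xgetPex _ 1 X); exists s; rewrite -Xs; exists 1 => //; exact: iota1.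
have : X (phi t) by rewrite -fixX; exists t => //; exists 1 => //; exact: iota1.
move: (Xt); rewrite -{1 2}Xs => -[g _ gs] [h _ hs].
exists (g * h^-1); rewrite /= -hs -iota_mul -mulgA mulVg mulg1.
by rewrite gs.
Qed.

Lemma centralizer_subgroup N t : subgroup N -> subgroup (centralizer N t).
Proof.
move=> sN; apply: subgroup_intro.
- by split; [exact: subg1 | apply: commute_sym; exact: commute1].
- move=> x y [Nx xt] [Ny yt]; split; first exact: subgM.
  by apply: commute_sym; apply: commuteM; exact: commute_sym.
- move=> x [Nx xt]; split; first exact: subgV.
  by apply: commute_sym; apply: commuteV; exact: commute_sym.
Qed.

Lemma class_average_subgroup N K t g : normal_subgroup N setT -> normal_subgroup K setT ->
  K `<=` N -> finite_index K setT -> finite_index N setT -> NR_group N ->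
  (forall x, N x -> N (phi x)) -> (forall x, K x -> K (phi x)) -> t = iota g (phi t) ->
  let C := centralizer setT t in
  let R A : rat := ((subgroup_index A C)%:R^-1 *
    \sum_(Y \in lcosets A C) ((tau A (iota (xget 1%g Y) \o (iota g \o phi)))%:R : rat))%R in
  R (centralizer K t) = R (centralizer N t).
Proof.
move=> nN nK KN fK fN nrN phiN phiK tg C R; rewrite {}/R.
have [sN sT _ _] := nN; have [sK _ _ _] := nK.
move: (erefl (centralizer N t)) (erefl (centralizer K t)).
move: {-2}(centralizer N t) {-2}(centralizer K t) => D D' DK D'K.
have sC : subgroup C by exact: centralizer_subgroup.
have sD : subgroup D by rewrite DK; exact: centralizer_subgroup.
have sD' : subgroup D' by rewrite D'K; exact: centralizer_subgroup.
have DE : D = N `&` C by rewrite DK; apply/seteqP; split=> x [] // Nx []; split.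
have D'E : D' = K `&` C by rewrite D'K; apply/seteqP; split=> x [] // Kx []; split.
have DC : D `<=` C by rewrite DE => x [].
have D'D : D' `<=` D by rewrite DE D'E => x [/KN].
have fDC : finite_index D C by rewrite DE; exact: finite_indexI.
have fD'C : finite_index D' C by rewrite D'E; exact: finite_indexI.
have fD'D : finite_index D' D.
  by apply: sub_finite_set fD'C => _ [x Dx <-]; exists x => //; exact: DC.
have normC M : normal_subgroup M setT -> normal_subgroup (M `&` C) C.
  move=> [sM _ _ MM]; split=> //; [exact: subgroupI|].
  by move=> b a Cb [Ma Ca]; split; [exact: MM | exact: subg_iota].
have nDC : normal_subgroup D C by rewrite DE; exact: normC.
have nD'D : normal_subgroup D' D.
  have [_ _ _ h] : normal_subgroup D' C by rewrite D'E; exact: normC.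
  by split=> // b a /DC Cb D'a; exact: h.
pose psi c := iota c \o (iota g \o phi).
have psiM c A : morph_on A (psi c).
  by move=> x y _ _; rewrite /psi /= gmulfM !iotaE !conjMg.
have psiC c x : C c -> C x -> C (psi c x).
  move=> Cc [_ xt]; apply: subg_iota => //; split=> //.
  rewrite /= tg; apply/commgP; rewrite !iotaE -conjRg conjg_eq1; apply/commgP.
  exact: gmulf_commute.
have psiN c M x : normal_subgroup M setT -> (forall x, M x -> M (phi x)) -> M x -> M (psi c x).
  by move=> [_ _ _ MM] phiM Mx; exact: (MM _ _ I (MM _ _ I (phiM _ Mx))).
have psiD c x : C c -> D x -> D (psi c x).
  by move=> Cc; rewrite DE => -[Nx Cx]; split; [exact: psiN | exact: psiC].
have psiD' c x : C c -> D' x -> D' (psi c x).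
  by move=> Cc; rewrite D'E => -[Kx Cx]; split; [exact: psiN | exact: psiC].
have DN : D `<=` N by rewrite DE => x [].
pose f c : rat := (tau D (psi c))%:R%R.
(* Since D is normal in C, x y = (x y x^-1) x only adds a twist by an element of D, which [tau_iota]
   removes. *)
have fD x y : C x -> D y -> f (x * y) = f x.
  move=> Cx Dy; have [_ _ _ h] := nDC; have Dxy := h _ _ Cx Dy.
  rewrite /f -(tau_iota sN nrN sD DN (psiM x D) (fun z => psiD x z Cx) Dxy).
  congr (tau _ _)%:R%R; apply/funext => z; rewrite /psi /= -[RHS]iota_mul.
  by congr (iota _ _); rewrite /iota mulgVK.
rewrite -(average_cosets sD' sD sC D'D DC fD'C fDC fD); congr (_ * _)%R.
apply: eq_fsbigr => Y; rewrite inE => LY.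
have [Cc _] := lcoset_repr sD' sC (subset_trans D'D DC) LY.
rewrite /f -(tau_finite_index sN nrN DN nD'D fD'D (psiM _ D) (fun z => psiD _ z Cc)
  (fun z => psiD' _ z Cc)) //.
Qed.

Lemma Rtilde_subgroup N K : normal_subgroup N setT -> normal_subgroup K setT -> K `<=` N ->
  finite_index K setT -> finite_index N setT -> NR_group N ->
  (forall x, N x -> N (phi x)) -> (forall x, K x -> K (phi x)) ->
  Rtilde phi K = Rtilde phi N.
Proof.
move=> nN nK KN fK fN nrN phiN phiK; apply: eq_fsbigr => X; rewrite inE => fixX.
exact: (class_average_subgroup nN nK KN fK fN nrN phiN phiK (fixed_class_repr fixX (erefl _))).
Qed.

End Rtilde.

Theorem proposition4p3 (G : groupType) (hG : virtually_polycyclic G)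
    (phi : {multiplicative G -> G}) (N N' : set G)
    (hN : normal_subgroup N setT) (hN' : normal_subgroup N' setT)
    (iN : finite_index N setT) (iN' : finite_index N' setT)
    (nrN : NR_group N) (nrN' : NR_group N')
    (phiN : phi @` N `<=` N) (phiN' : phi @` N' `<=` N') :
  Rtilde phi N = Rtilde phi N'.
Proof.
have [sN sT _ nN] := hN; have [sN' _ _ nN'] := hN'.
have phiNx x : N x -> N (phi x) by move=> Nx; apply: phiN; exists x.
have phiN'x x : N' x -> N' (phi x) by move=> N'x; apply: phiN'; exists x.
have nK : normal_subgroup (N `&` N') setT.
  by split=> //; [exact: subgroupI | move=> b a Tb [Na N'a]; split; [exact: nN | exact: nN']].
have fK := finite_index_setI iN iN'.
have phiK x : (N `&` N') x -> (N `&` N') (phi x).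
  by move=> [Nx N'x]; split; [exact: phiNx | exact: phiN'x].
rewrite -(Rtilde_subgroup hN nK (@subIsetl _ _ _) fK iN nrN phiNx phiK).
exact: (Rtilde_subgroup hN' nK (@subIsetr _ _ _) fK iN' nrN' phiN'x phiK).
Qed.
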